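(* For an integer $k\ge 0$ let $$\mu(\mathbb{S}^k)=\min\left\{|W| : H_i(\mathcal{C}^B_*[W])\cong\mathbb{Z}\text{ for } i\in\{0,k\},\ \text{and } H_i(\mathcal{C}^B_*[W])=0 \text{ for } i\notin\{0,k\}\right\},$$ where the minimum is over all finite sets of words $W\subset\Sigma^*$ over all finite alphabets $\Sigma$ (with any number of symbols). Then: 1. $\mu(\mathbb{S}^0)=1$; 2. $\mu(\mathbb{S}^1)=4$; 3. $\mu(\mathbb{S}^2)=8$; 4. for every $k\ge 3$, $\mu(\mathbb{S}^k)\le 3^{k+1}-1$.
   Context: Let $\Sigma$ be a finite alphabet. $\Sigma^*$ is the set of finite words over $\Sigma$, $1$ denotes the empty word, $x[1]$ is the first symbol of a nonempty word $x$, and $[m]=\{1,\dots,m\}$. Blocks. For $m\ge 0$ an $m$-block is a formal expression $\sigma=x_0(1,a_1)x_1(1,a_2)\cdots x_{m-1}(1,a_m)x_m$ with $x_i\in\Sigma^*$, $a_i\in\Sigma$ (an element of $\Sigma^*\times E\times\Sigma^*\times\dots\times E\times\Sigma^*$ with $m$ factors $E=\{(1,a):a\in\Sigma\}$); $\dim\sigma=m$; $0$-blocks are words. Equivalence of $m$-blocks is defined recursively: $0$-blocks are equivalent iff equal as words; for $m\ge1$, writing $\sigma_i=\hat\sigma_i(1,a_i)x_i$ with $\hat\sigma_i$ an $(m-1)$-block, $a_i\in\Sigma$, $x_i\in\Sigma^*$, one has $\sigma_1\equiv\sigma_2$ iff $\hat\sigma_1a_1x_1\equiv\hat\sigma_2a_2x_2$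 and $\hat\sigma_1x_1\equiv\hat\sigma_2x_2$. A block is in canonical form if for every $i=1,\dots,m$ the word $x_i$ is empty or $x_i[1]\ne a_i$; each equivalence class contains exactly one block in canonical form. Blocks are considered up to equivalence (''='' means equivalent). Sub-blocks and vertices. For disjoint $I^+,I^-\subset[m]$, $\sigma(I^+,I^-)=x_0\lambda_1x_1\cdots\lambda_mx_m$ where $\lambda_i=a_i$ if $i\in I^+$, $\lambda_i=1$ if $i\in I^-$, and $\lambda_i=(1,a_i)$ otherwise; it is an $(m-|I^+|-|I^-|)$-block. For $I\subset[m]$, $v_I(\sigma)=\sigma(I,[m]\setminus I)\in\Sigma^*$, and $V(\sigma)=\{v_I(\sigma):I\subset[m]\}$. Validity. $\sigma$, with canonical form $x_0(1,a_1)x_1\cdots(1,a_m)x_m$, is valid if for every $i=1,\dots,m-1$ with $x_i=1$ one has $a_i\ne a_{i+1}$. Insertion Chain Complex. For $W\subset\Sigma^*$, let $\mathcal{C}^B[W]$ be the set of all valid blocks $\sigma$ with $V(\sigma)\subset W$. The chain complex $\mathcal{C}^B_*[W]$ has as $k$-th chain group the free abelian group on the $k$-dimensional elements of $\mathcal{C}^B[W]$, with boundary $\partial\sigma=\sum_{i=1}^m(-1)^{i+1}\left[\overline F_i(\sigma)-\underline F_i(\sigma)\right]$ for a valid $m$-block with $m\ge1$, where $\overline F_i(\sigma)=\sigma(\{i\},\emptyset)$, and $\underline F_i(\sigma)=\sigma(\emptyset,\{i\})$ if this is a valid block and $\underline F_i(\sigma)=0$ otherwise; $\partial=0$ on $0$-blocks.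 Homology has $\mathbb{Z}$ coefficients and is not reduced. *)

(* Defs.v *)
From HB Require Import structures.
From mathcomp Require Import all_boot all_order all_algebra.
From mathcomp Require Import generic_quotient ring_quotient.
From mathcomp Require Import finmap freeg boolp.

Set Implicit Arguments.
Unset Strict Implicit.
Unset Printing Implicit Defensive.

Import GRing.Theory.

(* Homology at V of U --f--> V --g--> W, as an abelian group:
   the kernel of g modulo its elements that lie in the image of f. *)
Section Homology.
Local Open Scope ring_scope.
Variables (U V W : zmodType) (f : {additive U -> V}) (g : {additive V -> W}).

Definition ker_pred : {pred V} := fun x => g x == 0.

Lemma ker_pred_closed : zmod_closed ker_pred.
Proof.
split=> [|x y]; rewrite !unfold_in ?raddf0 // => /eqP gx /eqP gy.
by rewrite raddfB gx gy subrr.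
Qed.
HB.instance Definition _ := GRing.isZmodClosed.Build V ker_pred ker_pred_closed.

Definition cycle := {x : V | ker_pred x}.
HB.instance Definition _ := SubChoice.on cycle.
HB.instance Definition _ := [SubChoice_isSubZmodule of cycle by <:].

Definition bnd_pred : {pred cycle} := fun z => `[< exists u : U, f u = val z >].

Lemma bnd_pred_closed : zmod_closed bnd_pred.
Proof.
split=> [|x y]; rewrite !unfold_in.
  by apply/asboolP; exists 0; rewrite !raddf0.
move=> /asboolP[u ux] /asboolP[v vy]; apply/asboolP; exists (u - v).
by rewrite !raddfB ux vy.
Qed.
HB.instance Definition _ :=
  GRing.isZmodClosed.Build cycle bnd_pred bnd_pred_closed.

Definition homology : zmodType := Quotient.quot bnd_pred.

End Homology.

Definition iso_int (G : zmodType) := exists h : {additive G -> int}, bijective h.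
Definition trivial_group (G : zmodType) := forall x : G, x = 0%R.

Section Blocks.
Variable A : choiceType.

(* Ext s a x is the block s(1,a)x: blocks grow on the right, as in the
   recursive definition of their equivalence. *)
Inductive block := Word of seq A | Ext of block & A & seq A.

Fixpoint dim (s : block) : nat := if s is Ext t _ _ then (dim t).+1 else 0.

Fixpoint first_word (s : block) : seq A :=
  match s with Word x => x | Ext t _ _ => first_word t end.
Fixpoint edges (s : block) : seq (A * seq A) :=
  if s is Ext t a x then rcons (edges t) (a, x) else [::].
Definition block_code (s : block) := (first_word s, edges s).
Definition block_decode (c : seq A * seq (A * seq A)) : block :=
  foldl (fun t e => Ext t e.1 e.2) (Word c.1) c.2.
Lemma block_codeK : cancel block_code block_decode.
Proof.
elim=> [x|t IHt a x] //; rewrite /block_decode /block_code /= foldl_rcons.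
by congr Ext.
Qed.
HB.instance Definition _ := Choice.copy block (can_type block_codeK).

(* The word w appended to the last word of s. *)
Definition bcat (s : block) (w : seq A) : block :=
  match s with Word x => Word (x ++ w) | Ext t a x => Ext t a (x ++ w) end.

(* Equivalence of two m-blocks, by recursion on m. *)
Fixpoint mequiv (m : nat) (s t : block) : bool :=
  match m, s, t with
  | 0, Word x, Word y => x == y
  | m'.+1, Ext s' a x, Ext t' b y =>
      mequiv m' (bcat s' (a :: x)) (bcat t' (b :: y))
        && mequiv m' (bcat s' x) (bcat t' y)
  | _, _, _ => false
  end.
Definition bequiv : rel block := fun s t => mequiv (dim s) s t.

Fixpoint canonical (s : block) : bool :=
  if s is Ext t a x then canonical t && (ohead x != Some a) else true.

(* The condition defining validity, read on a block in canonical form. *)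
Fixpoint separated (s : block) : bool :=
  match s with
  | Ext (Ext _ a x as t) b _ => separated t && ((x == [::]) ==> (a != b))
  | _ => true
  end.

Definition valid (s : block) : Prop :=
  exists c, [/\ canonical c, bequiv c s & separated c].

(* The sub-block s(P, M); positions are numbered from 1, and only the traces
   of P and M on [1, dim s] matter. *)
Fixpoint subblock (s : block) (P M : {pred nat}) : block :=
  if s is Ext t a x then
    let u := subblock t P M in
    if (dim t).+1 \in P then bcat u (a :: x)
    else if (dim t).+1 \in M then bcat u x
    else Ext u a x
  else s.

(* v_I(s); the sub-block involved is a 0-block, see subblock_vertex. *)
Definition vertex (s : block) (I : {pred nat}) : seq A :=
  first_word (subblock s I (predC I)).

Definition upper_facet (i : nat) (s : block) := subblock s (pred1 i) pred0.
Definition lower_facet (i : nat) (s : block) := subblock s pred0 (pred1 i).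

(* Basic properties: equivalence is an equivalence relation, dimension, vertices,
   validity and facets depend only on the equivalence class, and every class
   contains exactly one canonical block. *)

Lemma dim_bcat s w : dim (bcat s w) = dim s. Proof. by case: s. Qed.

Lemma bcat_cat s w w' : bcat (bcat s w) w' = bcat s (w ++ w').
Proof. by case: s => [x|t a x] /=; rewrite catA. Qed.

Lemma subblock_vertex s I : subblock s I (predC I) = Word (vertex s I).
Proof.
rewrite /vertex; elim: s => [x|t IHt a x] //=.
by case: ifP => [_|nI]; rewrite ?(negbT nI : _ \in predC I) /= IHt.
Qed.

Lemma vertexE t a x I :
  vertex (Ext t a x) I = vertex t I ++ (if (dim t).+1 \in I then a :: x else x).
Proof.
rewrite {1}/vertex /=; case: ifP => [_|nI];
by rewrite ?(negbT nI : _ \in predC I) /= subblock_vertex.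
Qed.

Lemma vertex_bcat s w I : vertex (bcat s w) I = vertex s I ++ w.
Proof. by case: s => [x|t a x] //=; rewrite !vertexE; case: ifP => _; rewrite -catA. Qed.

Lemma eq_vertex s I J : {in [pred i | 0 < i <= dim s], I =i J} ->
  vertex s I = vertex s J.
Proof.
elim: s => [x|t IHt a x] //= IJ; rewrite !vertexE IJ ?inE //=.
by rewrite IHt // => i /andP[i0 it]; apply: IJ; rewrite inE i0 /= leqW.
Qed.

Lemma mequiv_dim m s t : mequiv m s t -> dim s = m /\ dim t = m.
Proof.
elim: m s t => [|m IHm] [x|s a x] [y|t b y] //= /andP[_ /IHm].
by rewrite !dim_bcat => -[-> ->].
Qed.

Lemma mequivP m s t : dim s = m -> dim t = m ->
  reflect (forall I, vertex s I = vertex t I) (mequiv m s t).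
Proof.
elim: m s t => [|m IHm] [x|s a x] [y|t b y] //=.
  by move=> _ _; apply: (iffP eqP) => [-> //|/(_ pred0)].
move=> [ds] [dt]; apply: (iffP andP) => [[e1 e2] I|e].
  have d1 w : dim (bcat s w) = m by rewrite dim_bcat.
  have d2 w : dim (bcat t w) = m by rewrite dim_bcat.
  have := elimT (IHm _ _ (d1 _) (d2 _)) e1 I.
  have := elimT (IHm _ _ (d1 _) (d2 _)) e2 I.
  rewrite !vertex_bcat !vertexE ds dt => {}e2 {}e1.
  by case: ifP => _; [apply: e1 | apply: e2].
split; apply/IHm; rewrite ?dim_bcat // => I; rewrite !vertex_bcat.
  have := e [predU I & pred1 m.+1]; rewrite !vertexE ds dt !inE eqxx orbT.
  rewrite (@eq_vertex s _ I) ?(@eq_vertex t _ I) // => i; rewrite !inE ?ds ?dt;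
  by move=> /andP[_ im]; rewrite ltn_eqF ?ltnS ?orbF.
have := e [predD I & pred1 m.+1]; rewrite !vertexE ds dt !inE eqxx.
rewrite (@eq_vertex s _ I) ?(@eq_vertex t _ I) // => i; rewrite !inE ?ds ?dt;
by move=> /andP[_ im]; rewrite ltn_eqF ?ltnS.
Qed.

Lemma bequivP s t :
  reflect (dim s = dim t /\ forall I, vertex s I = vertex t I) (bequiv s t).
Proof.
apply: (iffP idP) => [e|[d e]].
  have [_ d] := mequiv_dim e; split=> //; exact/(mequivP (erefl _) d).
exact/mequivP.
Qed.

Lemma bequiv_is_equiv : equiv_class_of bequiv.
Proof.
split=> [s|s t|t s u]; first exact/bequivP.
  by apply/bequivP/bequivP => -[d e]; split.
move=> /bequivP[d e] /bequivP[d' e']; apply/bequivP.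
by split=> [|I]; rewrite ?d ?e.
Qed.
Canonical bequiv_equiv := EquivRelPack bequiv_is_equiv.
Canonical bequiv_encModRel := defaultEncModRel bequiv.

Lemma bequiv_refl s : bequiv s s. Proof. exact: equiv_refl. Qed.
Lemma bequiv_sym s t : bequiv s t = bequiv t s. Proof. exact: equiv_sym. Qed.
Lemma bequiv_trans t s u : bequiv s t -> bequiv t u -> bequiv s u.
Proof. exact: equiv_trans. Qed.

Lemma dim_equiv s t : bequiv s t -> dim s = dim t.
Proof. by case/bequivP. Qed.

Lemma vertex_equiv s t I : bequiv s t -> vertex s I = vertex t I.
Proof. by case/bequivP. Qed.

Lemma valid_equiv s t : bequiv s t -> valid s -> valid t.
Proof.
by move=> st [c [cc cs sc]]; exists c; split=> //; apply: bequiv_trans st.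
Qed.

Lemma iota1S n : iota 1 n.+1 = rcons (iota 1 n) n.+1.
Proof. by rewrite -(addn1 n) iotaD add1n addn1 cats1. Qed.

Lemma dim_subblock s P M :
  dim (subblock s P M) =
  count [pred i | i \notin [predU P & M]] (iota 1 (dim s)).
Proof.
elim: s => [x|t IHt a x] //.
rewrite [dim (Ext _ _ _)]/= iota1S -cats1 count_cat -IHt /= !inE.
case: (_ \in P) => /=; rewrite ?dim_bcat ?addn0 //.
by case: (_ \in M) => /=; rewrite ?dim_bcat ?addn0 ?addn1.
Qed.

Lemma vertex_subblock s P M I :
  vertex (subblock s P M) I =
  vertex s [pred i | (i \in P) || (i \notin M) &&
    (count [pred j | j \notin [predU P & M]] (iota 1 i) \in I)].
Proof.
set J := [pred i | _].
have e i : (i.+1 \in J) = (i.+1 \in P) || (i.+1 \notin M) &&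
  (count [pred j | j \notin [predU P & M]] (iota 1 i) +
   (i.+1 \notin [predU P & M]) \in I).
  by rewrite [LHS]inE iota1S -cats1 count_cat /= addn0.
elim: s => [x|t IHt a x] //=; rewrite vertexE e -dim_subblock !inE.
case: (_ \in P) => /=; first by rewrite vertex_bcat IHt.
case: (_ \in M) => /=; first by rewrite vertex_bcat IHt.
by rewrite vertexE IHt addn1.
Qed.

Lemma subblock_equiv s t P M :
  bequiv s t -> bequiv (subblock s P M) (subblock t P M).
Proof.
move=> /bequivP[d e]; apply/bequivP; split; first by rewrite !dim_subblock d.
by move=> I; rewrite !vertex_subblock e.
Qed.

Lemma dim_facet s i : 0 < i <= dim s ->
  dim (upper_facet i s) = (dim s).-1 /\ dim (lower_facet i s) = (dim s).-1.
Proof.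
have facet_out t : dim t < i -> dim (upper_facet i t) = dim t /\
    dim (lower_facet i t) = dim t.
  rewrite /upper_facet /lower_facet; elim: t => [x|t IHt a x] //= ti.
  have [e1 e2] := IHt (ltnW ti).
  by rewrite !inE (ltn_eqF ti) /= e1 e2.
rewrite /upper_facet /lower_facet.
elim: s => [x|t IHt a x] /=; first by case: i {facet_out}.
move=> /andP[i0]; rewrite leq_eqVlt => /predU1P[ei|it].
  have [] := facet_out t; first by rewrite ei.
  by rewrite !inE -ei eqxx /= !dim_bcat.
have [] := IHt; first by rewrite i0.
rewrite !inE (gtn_eqF it) /= => -> ->; rewrite prednK //.
by rewrite (leq_trans i0).
Qed.

Fixpoint canon_cat (s : block) (w : seq A) : block :=
  match s with
  | Word x => Word (x ++ w)
  | Ext t a x => let y := x ++ w in let n := find (predC1 a) y in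
      Ext (canon_cat t (take n y)) a (drop n y)
  end.

Lemma canon_catP s w : canonical (canon_cat s w) /\ bequiv (canon_cat s w) (bcat s w).
Proof.
elim: s w => [x|t IHt a x] w; first by split=> //; exact: bequiv_refl.
rewrite /=; set y := x ++ w; set n := find _ y.
have [-> e] := IHt (take n y); split=> /=.
  have [hy|] := boolP (has (predC1 a) y); last first.
    by move=> /hasNfind; rewrite /n => ->; rewrite drop_size.
  rewrite (drop_nth a) -?has_find //=; apply/eqP => -[].
  by apply/eqP; exact: (nth_find a hy).
have dt := dim_equiv e; rewrite dim_bcat in dt.
have take_a : take n y = nseq n a.
  apply: (@eq_from_nth _ a) => [|i].
    by rewrite size_nseq size_takel // find_size.
  rewrite size_takel ?find_size // => ni.
  rewrite nth_take // nth_nseq ni; apply/eqP.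
  by have /= /negbFE := before_find a ni.
apply/bequivP; split=> /= [|I]; first by rewrite dt.
rewrite !vertexE dt (vertex_equiv I e) vertex_bcat -catA; congr (_ ++ _).
case: ifP => _; last by rewrite cat_take_drop.
rewrite -{3}(cat_take_drop n y) take_a -cat_cons -cat1s catA.
by rewrite -[a :: nseq n a]/(nseq n.+1 a) -addn1 nseqD.
Qed.

Lemma canonical_exists s : exists2 c, canonical c & bequiv c s.
Proof.
have [cc e] := canon_catP s [::]; exists (canon_cat s [::]) => //.
by move: e; case: (s) => [x|t a x] /=; rewrite cats0.
Qed.

Lemma canonical_uniq s t : canonical s -> canonical t -> bequiv s t -> s = t.
Proof.
have main (u u' : seq A) a b x y : u ++ x = u' ++ y ->
    u ++ a :: x = u' ++ b :: y -> ohead y != Some b -> size u' <= size u ->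
    [/\ u = u', a = b & x = y].
  move=> e1 e2 yb le.
  have eu' : u' = take (size u') u.
    by move/(congr1 (take (size u'))): e1; rewrite takel_cat // => ->; rewrite take_size_cat.
  move: e1 e2; rewrite -{1 2}(cat_take_drop (size u') u) -eu' -!catA.
  move=> /eqP; rewrite eqseq_cat // eqxx => /eqP e1.
  move=> /eqP; rewrite eqseq_cat // eqxx => /eqP e2.
  have := cat_take_drop (size u') u; rewrite -eu'.
  case: (drop _ u) e1 e2 => [|c z] /= e1 e2 e3.
    by case: e2 => -> ->; rewrite -e3 cats0.
  by case: e2 yb => <- _; rewrite -e1 eqxx.
elim: s t => [x|s IHs a x] [y|t b y] //=.
  by move=> _ _ /bequivP[_ /(_ pred0)] e; congr Word.
move=> /andP[cs xa] /andP[ct yb] /bequivP[[d] e].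
have split_e I : [/\ vertex s I = vertex t I, a = b & x = y].
  have e1 : vertex s I ++ x = vertex t I ++ y.
    have := e [predD I & pred1 (dim s).+1]; rewrite !vertexE -d !inE eqxx /=.
    rewrite (@eq_vertex s _ I) ?(@eq_vertex t _ I) // => i; rewrite !inE -?d;
    by move=> /andP[_ im]; rewrite ltn_eqF ?ltnS.
  have e2 : vertex s I ++ a :: x = vertex t I ++ b :: y.
    have := e [predU I & pred1 (dim s).+1]; rewrite !vertexE -d !inE eqxx orbT.
    rewrite (@eq_vertex s _ I) ?(@eq_vertex t _ I) // => i; rewrite !inE -?d;
    by move=> /andP[_ im]; rewrite ltn_eqF ?ltnS ?orbF.
  have [le|/ltnW le] := leqP (size (vertex t I)) (size (vertex s I)).
    exact: main.
  by have [] := main _ _ _ _ _ _ (esym e1) (esym e2) xa le.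
have [_ -> ->] := split_e pred0.
by rewrite (IHs t) //; apply/bequivP; split=> // I; have [] := split_e I.
Qed.

Lemma valid_upper_facet s i : 0 < i <= dim s -> valid s -> valid (upper_facet i s).
Proof.
move=> si [c [cc cs sc]]; exists (upper_facet i c).
suff [c1 c2] : canonical (upper_facet i c) /\ separated (upper_facet i c).
  by split=> //; apply: subblock_equiv.
rewrite -(dim_equiv cs) in si; rewrite /upper_facet.
have out t : dim t < i -> subblock t (pred1 i) pred0 = t.
  elim: t => [x|t IHt a x] //= ti.
  by rewrite !inE (ltn_eqF ti) /= IHt // ltnW.
elim: c cc {cs} sc si => [x|t IHt a x] //= /andP[ct xa] st /andP[i0].
rewrite leq_eqVlt => /predU1P[ei|it].
  rewrite !inE -ei eqxx out ?ei //.
  case: t {IHt out ei} ct st => [y|t b y] //= /andP[ct yb] /andP[st].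
  by case: y yb => [_ /= ba|? ? ? _] /=; rewrite ct ?(contraNneq _ ba) // => -[->].
rewrite !inE (gtn_eqF it) /=.
have [] := IHt ct; first by case: (t) st => //= ? ? ? /andP[].
  by rewrite i0.
case: t {IHt} ct st it => [y|t b y] //= ct /andP[st yab] it -> s1.
rewrite xa; split=> //; move: s1; rewrite !inE.
case: eqVneq => [e|ne] /=; last by move=> ->.
rewrite out ?e //.
by case: t {ct st it yab e} => [z|t c z] //= ->; case: z.
Qed.

End Blocks.
Arguments Word {A}.

Section Complex.
Local Open Scope ring_scope.
Local Open Scope quotient_scope.
Variables (A : choiceType) (W : {fset seq A}).

Definition bclass := {eq_quot (@bequiv A)}.
HB.instance Definition _ := Choice.on bclass.
HB.instance Definition _ : EqQuotient _ (@bequiv A) bclass :=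
  EqQuotient.on bclass.

Definition in_CB (s : block A) : Prop :=
  valid s /\ forall I : {pred nat}, vertex s I \in W.

Lemma in_CB_equiv s t : bequiv s t -> in_CB s -> in_CB t.
Proof.
move=> st [vs Vs]; split; first exact: valid_equiv vs.
by move=> I; rewrite -(vertex_equiv I st).
Qed.

(* The k-dimensional elements of C^B[W]. *)
Definition cell_pred (k : nat) : pred bclass :=
  fun q => `[< dim (repr q) = k /\ in_CB (repr q) >].
Definition cell (k : nat) := {q : bclass | cell_pred k q}.
HB.instance Definition _ k := SubChoice.on (cell k).

Lemma cell_pred_pi k s :
  reflect (dim s = k /\ in_CB s) (cell_pred k (\pi_bclass s)).
Proof.
have e : bequiv (repr (\pi_bclass s)) s.
  by apply/(eqquotP bclass); rewrite reprK.
apply: (iffP (asboolP _)) => -[ds cs].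
  by split; [rewrite -(dim_equiv e) | apply: in_CB_equiv cs].
split; first by rewrite (dim_equiv e).
by apply: in_CB_equiv cs; rewrite bequiv_sym.
Qed.

Lemma in_CB_subblock s P M :
  in_CB s -> valid (subblock s P M) -> in_CB (subblock s P M).
Proof. by move=> [_ Vs] v; split=> // I; rewrite vertex_subblock. Qed.

Lemma cell_upper_facet k s i : (0 < i <= k)%N ->
  dim s = k -> in_CB s -> cell_pred k.-1 (\pi_bclass (upper_facet i s)).
Proof.
move=> ik ds cs; apply/cell_pred_pi; rewrite -ds in ik *; split.
  by have [] := dim_facet ik.
by apply: in_CB_subblock => //; apply: valid_upper_facet => //; case: cs.
Qed.

Lemma cell_lower_facet k s i : (0 < i <= k)%N -> dim s = k -> in_CB s ->
  reflect (valid (lower_facet i s)) (cell_pred k.-1 (\pi_bclass (lower_facet i s))).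
Proof.
move=> ik ds cs; apply: (iffP (cell_pred_pi _ _)) => [[_ []] // | v].
rewrite -ds in ik *; split; first by have [] := dim_facet ik.
exact: in_CB_subblock.
Qed.

Definition chain (k : nat) := {freeg (cell k) / int}.

(* The generator given by the class of s, and 0 if this class is not a k-cell.
   For a facet of a (k+1)-cell, the latter happens exactly when the facet is
   not valid, hence never for an upper facet: see cell_upper_facet and
   cell_lower_facet. *)
Definition generator (k : nat) (s : block A) : chain k :=
  if insub (\pi_bclass s) is Some c then << c >> else 0.

Definition cell_boundary (k : nat) (c : cell k) : chain k.-1 :=
  let s := repr (val c) in
  \sum_(1 <= i < k.+1) (-1) ^+ i.+1 *:
    (generator k.-1 (upper_facet i s) - generator k.-1 (lower_facet i s)).

(* The boundary out of degree 0 is an empty sum, hence zero. *)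
Definition boundary (k : nat) : chain k -> chain k.-1 :=
  fglift (@cell_boundary k).
HB.instance Definition _ (k : nat) :=
  GRing.isZmodMorphism.Build (chain k) (chain k.-1) (@boundary k)
    (lift_is_additive (@cell_boundary k)).

Definition ICC_homology (k : nat) : zmodType :=
  homology (@boundary k.+1) (@boundary k).

End Complex.

(* H_i is Z for i in {0, k} and 0 for the other i; for k = 0 the two indices
   coincide. *)
Definition sphere_homology (A : finType) (W : {fset seq A}) (k : nat) : Prop :=
  (forall i, i = 0 \/ i = k -> iso_int (ICC_homology W i)) /\
  (forall i, i <> 0 -> i <> k -> trivial_group (ICC_homology W i)).

Local Open Scope fset_scope.

(* mu(S^k) = n: the minimum is attained and equal to n. *)
Definition mu_sphere (k n : nat) : Prop :=
  (exists (A : finType) (W : {fset seq A}), sphere_homology W k /\ #|` W| = n) /\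
  (forall (A : finType) (W : {fset seq A}), sphere_homology W k -> n <= #|` W|).

(* Main.v *)
From HB Require Import structures.
From mathcomp Require Import all_boot all_order all_algebra.
From mathcomp Require Import generic_quotient ring_quotient.
From mathcomp Require Import finmap freeg boolp zify.
Require Import Defs.

Set Implicit Arguments.
Unset Strict Implicit.
Unset Printing Implicit Defensive.

Import GRing.Theory.

(** A valid block in canonical form is the same thing as a word, its top vertex,
    with marks on the last letters of some of its runs of equal letters: the
    vertices are the words obtained by deleting sets of marked letters, an upper
    facet forgets a mark, and a lower facet deletes a marked letter ([goodE],
    [marks_eq], [mem_verts], [marks_upper], [top_lower]).  Chains become integer
    combinations of such marked words ([ICC_trivial], [ICC_int]).  Upper facets
    keep the top word and occur once in the boundary, while lower facets have a
    shorter top word, so the boundary is triangular with respect to the length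
    of the top word; all arguments rest on this and on the vanishing of the
    square of the boundary ([bdry_bdry]).

    Existence.  Matching each cell with a cell of the next dimension, in such a
    way that the removals terminate, leaves a complex with the same homology on
    the unmatched cells ([sweep], [raised_cycle]); with one unmatched vertex and
    one unmatched k-cell this is the homology of the k-sphere
    ([sphere_of_matching]).  The empty word is a point.  The words b, ab, ba, bab
    form a circle of four edges, since the square with top word bab and marks on
    its two letters b also needs the vertex a.  For the words a, b, aa, ab, ba,
    bb, aba, bab, the three squares below aba and the three squares below bab
    are two hemispheres with a common equator.  In general, take the sorted words
    in k + 1 letters with every exponent at most 2, except the one whose
    exponents are all 1.  Their blocks are the faces of the cube [0, 2]^(k+1),
    subdivided at the integers, that avoid its centre, which gives the boundary
    of that cube ([grid_sphere]); there are 3^(k+1) - 1 such words ([card_grid]).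

    Minimality.  Take a longest word w among the top words of the cells of a
    nonzero cycle; its cells at w cancel among themselves on the facets through
    w.  For a cycle of dimension 1, two edges lead down from w, and the cycle
    needs a fourth word to leave their lower ends ([few_words_1cycle]).  For a
    cycle of dimension 2, the squares at w give at least three deletions of w and
    two distinct words below these.  An edge between these two levels lies in one
    more square of the cycle.  If that square goes up to another word as long as
    w, then this word has three deletions too, and two distinct words of the same
    length have at most two common deletions ([two_common_deletions]), which makes
    eight words.  Otherwise the square goes down to a seventh word, and if there
    are no others, the seven words are the vertices of a valid 3-block whose
    boundary accounts for the whole cycle ([seven_words], [few_words_2cycle]).
    So fewer than eight words carry no homology in dimension 2. *)

(** * Deleting one letter from a word *)

Section Words.
Variable A : choiceType.
Implicit Types (w u v : seq A) (p q : nat).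

Definition del p w := take p w ++ drop p.+1 w.

Lemma del0 a w : del 0 (a :: w) = w. Proof. by rewrite /del /= drop0. Qed.

Lemma delS a w p : del p.+1 (a :: w) = a :: del p w. Proof. by []. Qed.

(** The position p is in w and ends a maximal run of equal letters. *)
Definition rend w p := ohead (drop p.+1 w) != ohead (drop p w).

Lemma rend_size w p : rend w p -> p < size w.
Proof.
rewrite /rend; case: ltnP => // le.
by rewrite !drop_oversize // ltnW // ltnS.
Qed.

Lemma size_del w p : p < size w -> size (del p w) = (size w).-1.
Proof. by move=> pw; rewrite size_cat size_takel ?size_drop 1?ltnW //; lia. Qed.

Lemma del_cat_cons u a v : del (size u) (u ++ a :: v) = u ++ v.
Proof. by rewrite /del take_size_cat // -cat_rcons drop_size_cat // size_rcons. Qed.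

Lemma del_catl p u v : p < size u -> del p (u ++ v) = del p u ++ v.
Proof.
move=> pu; rewrite /del take_cat pu drop_cat; case: ltnP => pu'; first by rewrite catA.
have -> : p.+1 = size u by lia.
by rewrite drop_size subnn drop0 cats0.
Qed.

(** Deleting at p rather than at a later q shifts the letters between the two
    positions, so the two results agree only when these letters are all equal,
    which the change of letter after p excludes. *)
Lemma del_rend_neq w p q : p < q -> q < size w -> rend w p -> del p w <> del q w.
Proof.
elim: w p q => [|a w IHw] [|p] [|q] //=; rewrite ?ltnS => pq qw rp.
- rewrite del0 delS; case: w {IHw} rp qw => [|b w] //= /eqP ba _ [ab _].
  by apply: ba; rewrite ab.
- by case=> /IHw; apply.
Qed.

Lemma del_inj w p q : rend w p -> rend w q -> del p w = del q w -> p = q.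
Proof.
move=> rp rq e; have pw := rend_size rp; have qw := rend_size rq.
case: (ltngtP p q) => // lt; first by case: (del_rend_neq lt qw rp).
by case: (del_rend_neq lt pw rq).
Qed.

(** The letters from position q on are only shifted. *)
Lemma rend_delS w p q : p < q -> rend w q -> rend (del p w) q.-1.
Proof.
move=> pq rq; have qw := rend_size rq; rewrite /rend /del.
have sp : size (take p w) = p by rewrite size_takel //; lia.
rewrite !drop_cat sp; have /negbTE -> : ~~ (q.-1.+1 < p) by lia.
have /negbTE -> : ~~ (q.-1 < p) by lia.
rewrite !drop_drop.
have -> : q.-1.+1 - p + p.+1 = q.+1 by lia.
by have -> : q.-1 - p + p.+1 = q by lia.
Qed.

Lemma del_del w p q : p < q -> q < size w ->
  del p (del q w) = del q.-1 (del p w).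
Proof.
elim: w p q => [|a w IHw] [|p] [|q] //=; rewrite ?ltnS => pq qw.
  by rewrite del0 delS del0.
by rewrite !delS IHw //; case: q pq qw.
Qed.

(** At the first letter where the two words differ, a common deletion must delete
    that letter in one of them; both choices determine the result. *)
Lemma two_common_deletions w w' : size w = size w' -> w <> w' ->
  exists d1 d2, forall x p p', p < size w -> p' < size w' ->
    x = del p w -> x = del p' w' -> x = d1 \/ x = d2.
Proof.
elim: w w' => [|a v IHv] [|b v'] //= [sz] ne.
have [ab|ab] := eqVneq a b; last first.
  exists v, v' => x [|p] [|p'] _ _; rewrite ?del0 ?delS => ->; try by tauto.
  by case=> /eqP; rewrite (negbTE ab).
rewrite {}ab in ne *; have vv' : v <> v' by move=> e; apply: ne; rewrite e.
have [d1 [d2 IH]] := IHv _ sz vv'.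
exists (b :: d1), (b :: d2) => x [|p] [|p'] /=; rewrite ?ltnS ?del0 ?delS => pw pw' xv xv'.
- by case: vv'; rewrite -xv.
(* Deleting the common first letter b yields a word starting with b, hence the
   same result as deleting the next letter. *)
- rewrite {}xv in xv' *; rewrite xv' in IH.
  by have [] := IH (del p' v') 0 p'; rewrite ?del0 // => <-; [left | right].
- rewrite {}xv' in xv *; rewrite xv in IH.
  by have [] := IH (del p v) p 0; rewrite ?del0 // => <-; [left | right].
- have e : del p v = del p' v' by move: xv'; rewrite xv => -[].
  by rewrite xv; have [||||->|->] := IH (del p v) p p'; auto.
Qed.

End Words.

(** * Blocks as words with marked letters *)

Section MarkedWords.
Variable A : choiceType.
Implicit Types (w u v : seq A) (s t : block A) (p q : nat) (ms : seq nat).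

Definition top s := vertex s predT.

Definition bot s := vertex s pred0.

(** The positions in the top word of the letters carried by the edges, the
    rightmost first since blocks grow on the right. *)
Fixpoint marks s : seq nat :=
  if s is Ext t _ _ then size (top t) :: marks t else [::].

Lemma topE t a x : top (Ext t a x) = top t ++ a :: x.
Proof. by rewrite /top vertexE. Qed.

Lemma botE t a x : bot (Ext t a x) = bot t ++ x.
Proof. by rewrite /bot vertexE. Qed.

Lemma top_bcat s w : top (bcat s w) = top s ++ w.
Proof. exact: vertex_bcat. Qed.

Lemma marks_bcat s w : marks (bcat s w) = marks s. Proof. by case: s. Qed.

Lemma size_marks s : size (marks s) = dim s.
Proof. by elim: s => //= t ->. Qed.

Lemma marks_lt s p : p \in marks s -> p < size (top s).
Proof.
elim: s => //= t IHt a x; rewrite topE size_cat in_cons /=.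
by case/predU1P => [->|/IHt]; lia.
Qed.

Lemma marks_sorted s : sorted gtn (marks s).
Proof.
elim: s => //= t IHt a x; rewrite path_sortedE ?IHt ?andbT.
  by apply/allP => p /marks_lt.
by move=> y z k /= h1 h2; apply: ltn_trans h1.
Qed.

Lemma marks_eq s t : top s = top t -> marks s =i marks t -> s = t.
Proof.
move=> st /(irr_sorted_eq _ _ (marks_sorted s) (marks_sorted t)) st'.
have {st'} : marks s = marks t.
  by apply: st' => [y z k h1 h2|x] /=; [apply: ltn_trans h1 | rewrite ltnn].
elim: s t st => [x|s IHs a x] [y|t b y] //=; first by rewrite /top /vertex /= => ->.
rewrite !topE => e [sz ms]; move: e => /eqP.
by rewrite eqseq_cat // => /andP[/eqP e /eqP [-> ->]]; rewrite (IHs t).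
Qed.

Lemma uniq_marks s : uniq (marks s).
Proof.
apply: sorted_uniq (marks_sorted s) => [y z k h1 h2|x] /=; last by rewrite ltnn.
exact: ltn_trans h1.
Qed.

(** The canonical representatives of the valid classes. *)
Definition good s := canonical s && separated s.

Lemma rend_catl u v p : p.+1 < size u -> rend (u ++ v) p = rend u p.
Proof.
move=> pu; rewrite /rend !drop_cat pu ltnW //.
have hd y : 0 < size y -> ohead (y ++ v) = ohead y by case: y.
by rewrite !hd // size_drop subn_gt0 // ltnW.
Qed.

Lemma rend_mid u a v : rend (u ++ a :: v) (size u) = (ohead v != Some a).
Proof.
by rewrite /rend !drop_cat ltnn subnn ltnNge leqnSn subSn // subnn /= drop0.
Qed.

(** Moving an edge to the right through equal letters does not change the class,
    so a canonical block marks the last letter of a run; separation forbids two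
    marks in one run. *)
Lemma goodE s : good s = all (rend (top s)) (marks s).
Proof.
rewrite /good; elim: s => [x|t IHt a x] //=.
rewrite topE rend_mid; case: t IHt => [y|t b y] IHt; first by rewrite !andbT.
move: IHt; rewrite [in all _ (marks _)]/= [X in _ = X -> _]/= topE.
have -> : all (rend ((top t ++ b :: y) ++ a :: x)) (marks (Ext t b y)) =
    (ohead (y ++ a :: x) != Some b) && all (rend (top t ++ b :: y)) (marks t).
  rewrite /= -catA rend_mid; congr (_ && _).
  apply: eq_in_all => p /marks_lt pt.
  by rewrite catA rend_catl // size_cat /=; lia.
rewrite rend_mid => e; rewrite andbACA e [RHS]andbCA.
have -> : (ohead (y ++ a :: x) != Some b) =
    (ohead y != Some b) && ((y == [::]) ==> (b != a)).
  by case: (y) => [|c z] /=; rewrite ?andbT // (inj_eq Some_inj) eq_sym.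
by case: (all _ _); case: (ohead y != _); case: (ohead x != _); case: (_ ==> _).
Qed.

(** The block with top word w whose marks are the positions satisfying P. *)
Definition mk w (P : pred nat) : block A :=
  foldl (fun t a => if P (size (top t)) then Ext t a [::] else bcat t [:: a])
    (Word [::]) w.

Lemma mk_rcons w a P : mk (rcons w a) P =
  if P (size (top (mk w P))) then Ext (mk w P) a [::] else bcat (mk w P) [:: a].
Proof. exact: foldl_rcons. Qed.

Lemma top_mk w P : top (mk w P) = w.
Proof.
elim/last_ind: w => // w a IHw.
by rewrite mk_rcons; case: ifP; rewrite ?topE ?top_bcat IHw cats1.
Qed.

Lemma mem_marks_mk w P p : (p \in marks (mk w P)) = (p < size w) && P p.
Proof.
elim/last_ind: w => // w a IHw; rewrite mk_rcons top_mk size_rcons ltnS leq_eqVlt.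
case: ifP => Pw /=; rewrite ?marks_bcat ?in_cons ?top_mk IHw;
by have [->|pw] := eqVneq p (size w); rewrite /= ?ltnn ?Pw.
Qed.

Lemma good_mk w (P : pred nat) : (forall p, P p -> rend w p) -> good (mk w P).
Proof.
move=> Pw; rewrite goodE top_mk; apply/allP => p.
by rewrite mem_marks_mk => /andP[_ /Pw].
Qed.

(** * The vertices of a block *)

(** The results of deleting sets of positions in ms from w.  For a decreasing
    list the larger positions are deleted first, so that the smaller ones keep
    their meaning. *)
Fixpoint verts w ms : seq (seq A) :=
  if ms is p :: ms' then verts w ms' ++ verts (del p w) ms' else [:: w].

Lemma verts_catl u v ms : sorted gtn ms -> all (fun p => p < size u) ms ->
  verts (u ++ v) ms = [seq x ++ v | x <- verts u ms].
Proof.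
elim: ms u => [|p ms IH] u //= pms /andP[pu um].
have := pms; rewrite path_sortedE; last by move=> ? ? ? h1 h2; apply: ltn_trans h1.
move=> /andP[/allP pm sm].
rewrite map_cat IH // del_catl // IH //.
by apply/allP => q /pm /=; rewrite size_del //; lia.
Qed.

Lemma mem_verts s v :
  reflect (exists I, v = vertex s I) (v \in verts (top s) (marks s)).
Proof.
elim: s v => [x|t IHt a x] v.
  rewrite inE; apply: (iffP eqP) => [->|[I ->]] //.
  by exists (predT : pred nat).
have vE y : verts (top t ++ y) (marks t)
    = [seq z ++ y | z <- verts (top t) (marks t)].
  by rewrite verts_catl ?marks_sorted //; apply/allP => p /marks_lt.
rewrite topE /= mem_cat del_cat_cons !vE.
apply: (iffP orP) => [[] /mapP[z /IHt [I ->] ->]|[I ->]].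
- exists [predU I & pred1 (dim t).+1]; rewrite vertexE !inE eqxx orbT.
  by congr (_ ++ _); apply: eq_vertex => i; rewrite !inE => /andP[_ it]; rewrite ltn_eqF ?orbF.
- exists [predD I & pred1 (dim t).+1]; rewrite vertexE !inE eqxx.
  by congr (_ ++ _); apply: eq_vertex => i; rewrite !inE => /andP[_ it]; rewrite ltn_eqF.
- rewrite vertexE; case: ifP => _; [left|right]; apply/mapP; exists (vertex t I) => //;
  by apply/IHt; exists I.
Qed.

Lemma top_verts s : top s \in verts (top s) (marks s).
Proof. by apply/mem_verts; exists (predT : pred nat). Qed.

Lemma size_verts w ms v : v \in verts w ms -> size w <= size v + size ms.
Proof.
elim: ms w => [|p ms IH] w /=; first by rewrite inE => /eqP ->; rewrite addn0.
rewrite mem_cat => /orP[] /IH; first by lia.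
by rewrite size_cat size_take size_drop; case: ifP; lia.
Qed.

Lemma verts_subseq w ms v : v \in verts w ms -> subseq v w.
Proof.
elim: ms w => [|p ms IH] w /=; first by rewrite inE => /eqP ->.
rewrite mem_cat => /orP[/IH //|/IH] sv; apply: (subseq_trans sv).
rewrite /del -{3}(cat_take_drop p w) cat_subseq // -(add1n p) -drop_drop.
exact: drop_subseq.
Qed.

(** * Facets *)

Lemma facet_out s i : dim s < i -> upper_facet i s = s /\ lower_facet i s = s.
Proof.
rewrite /upper_facet /lower_facet.
elim: s => [x|t IHt a x] //= ti; have [-> ->] := IHt (ltnW ti).
by rewrite !inE (ltn_eqF ti).
Qed.

Lemma upper_ext t a x i : upper_facet i (Ext t a x) =
  if i == (dim t).+1 then bcat t (a :: x) else Ext (upper_facet i t) a x.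
Proof.
rewrite {1}/upper_facet /= !inE; case: (eqVneq i) => [->|ne].
  by have [e _] := @facet_out t (dim t).+1 (ltnSn _); rewrite -{3}e.
by [].
Qed.

Lemma lower_ext t a x i : lower_facet i (Ext t a x) =
  if i == (dim t).+1 then bcat t x else Ext (lower_facet i t) a x.
Proof.
rewrite {1}/lower_facet /= !inE; case: (eqVneq i) => [->|ne].
  by have [_ e] := @facet_out t (dim t).+1 (ltnSn _); rewrite -{3}e.
by [].
Qed.

(** The position of the i-th edge from the left, counted from 1. *)
Definition pos s i := nth 0 (marks s) (dim s - i).

Lemma pos_in s i : 0 < i <= dim s -> pos s i \in marks s.
Proof. by move=> si; rewrite mem_nth // size_marks; lia. Qed.

Lemma pos_ex s p : p \in marks s -> exists2 i, 0 < i <= dim s & pos s i = p.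
Proof.
move=> ps; exists (dim s - index p (marks s)); rewrite /pos.
  by move: ps; rewrite -index_mem size_marks; lia.
have := ps; rewrite -index_mem size_marks => lt.
by rewrite subKn ?nth_index // ltnW.
Qed.

Lemma pos_inj s i j : 0 < i <= dim s -> 0 < j <= dim s -> pos s i = pos s j -> i = j.
Proof.
move=> si sj /eqP; rewrite nth_uniq ?uniq_marks ?size_marks; lia.
Qed.

Lemma top_upper s i : top (upper_facet i s) = top s.
Proof.
elim: s => [x|t IHt a x] //; rewrite upper_ext; case: ifP => _.
  by rewrite top_bcat topE.
by rewrite !topE IHt.
Qed.

Lemma marks_upper s i : 0 < i <= dim s ->
  marks (upper_facet i s) = rem (pos s i) (marks s).
Proof.
elim: s => [x|t IHt a x]; first by case: i.
move=> /andP[i0 ti]; rewrite upper_ext /pos [dim _]/=.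
case: eqVneq => [->|ne]; first by rewrite marks_bcat subnn /= eqxx.
have it : 0 < i <= dim t by move: ti ne; rewrite i0 /=; lia.
rewrite /= top_upper IHt // subSn 1?(andP it).2 //=.
by case: eqP => // e; have := marks_lt (pos_in it); rewrite /pos -e ltnn.
Qed.

Lemma mem_marks_upper s i p : 0 < i <= dim s ->
  (p \in marks (upper_facet i s)) = (p != pos s i) && (p \in marks s).
Proof. by move=> si; rewrite marks_upper // mem_rem_uniq ?uniq_marks. Qed.

Lemma top_lower s i : 0 < i <= dim s -> top (lower_facet i s) = del (pos s i) (top s).
Proof.
elim: s => [x|t IHt a x]; first by case: i.
move=> /andP[i0 ti]; rewrite lower_ext /pos [dim _]/= topE.
case: eqVneq => [->|ne]; first by rewrite top_bcat subnn /= del_cat_cons.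
have it : 0 < i <= dim t by move: ti ne; rewrite i0 /=; lia.
by rewrite subSn ?(andP it).2 //= topE IHt // del_catl // (marks_lt (pos_in it)).
Qed.

Lemma size_top_lower s i : 0 < i <= dim s ->
  (size (top (lower_facet i s))).+1 = size (top s).
Proof.
move=> si; have := marks_lt (pos_in si).
by rewrite top_lower // => lt; rewrite size_del // prednK //; lia.
Qed.

Lemma bot_lower s i : bot (lower_facet i s) = bot s.
Proof.
elim: s => [x|t IHt a x] //; rewrite lower_ext; case: ifP => _.
  by rewrite /bot vertex_bcat vertexE.
by rewrite !botE IHt.
Qed.

Lemma bot_dels s : bot s = foldl (fun w p => del p w) (top s) (marks s).
Proof.
have dels_catl u v ms : sorted gtn ms -> all (fun p => p < size u) ms ->
    foldl (fun w p => del p w) (u ++ v) ms = foldl (fun w p => del p w) u ms ++ v.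
  elim: ms u => [|p ms IH] u //= pms /andP[pu um].
  have := pms; rewrite path_sortedE; last by move=> ? ? ? h1 h2; apply: ltn_trans h1.
  move=> /andP[/allP pm sm].
  rewrite del_catl // IH //.
  by apply/allP => q /pm /=; rewrite size_del //; lia.
elim: s => [x|t IHt a x] //; rewrite botE topE /= del_cat_cons dels_catl ?marks_sorted //.
  by rewrite IHt.
by apply/allP => p /marks_lt.
Qed.

Lemma good_upper s i : 0 < i <= dim s -> good s -> good (upper_facet i s).
Proof.
move=> si; rewrite !goodE => /allP gs; apply/allP => p.
by rewrite mem_marks_upper // => /andP[_ /gs]; rewrite top_upper.
Qed.

Lemma dim_upper s i : 0 < i <= dim s -> dim (upper_facet i s) = (dim s).-1.
Proof. by move=> /dim_facet[]. Qed.

Lemma dim_lower s i : 0 < i <= dim s -> dim (lower_facet i s) = (dim s).-1.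
Proof. by move=> /dim_facet[]. Qed.

End MarkedWords.

(** * The boundary on canonical blocks *)

Section Boundary.
Local Open Scope ring_scope.
Variable A : choiceType.
Implicit Types (w u v : seq A) (s t : block A) (i j : nat).

Definition canon s := canon_cat s [::].

Lemma canon_equiv s : bequiv (canon s) s.
Proof.
have [_] := canon_catP s [::]; rewrite -/(canon s).
by case: (s) => [x|t a x] /=; rewrite cats0.
Qed.

Lemma canonical_canon s : canonical (canon s).
Proof. by have [] := canon_catP s [::]. Qed.

Lemma canon_eq s t : bequiv s t -> canon s = canon t.
Proof.
move=> st; apply: canonical_uniq; rewrite ?canonical_canon //.
apply: bequiv_trans (canon_equiv s) _; apply: bequiv_trans st _.
by rewrite bequiv_sym canon_equiv.
Qed.

Lemma canon_id s : canonical s -> canon s = s.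
Proof. by move=> cs; apply: canonical_uniq; rewrite ?canonical_canon ?canon_equiv. Qed.

Lemma canon_good s : good s -> canon s = s.
Proof. by case/andP => /canon_id. Qed.

Lemma good_canon s : good (canon s) = separated (canon s).
Proof. by rewrite /good canonical_canon. Qed.

Lemma validE s : valid s <-> good (canon s).
Proof.
rewrite good_canon; split => [[c [cc cs sc]]|]; last first.
  by exists (canon s); rewrite canonical_canon canon_equiv.
by rewrite -(canon_eq cs) canon_id.
Qed.

Lemma dim_canon s : dim (canon s) = dim s.
Proof. exact: dim_equiv (canon_equiv s). Qed.

Lemma top_equiv s t : bequiv s t -> top s = top t.
Proof. exact: vertex_equiv. Qed.

Lemma bot_equiv s t : bequiv s t -> bot s = bot t.
Proof. exact: vertex_equiv. Qed.

Lemma lower_equiv i s t : bequiv s t -> bequiv (lower_facet i s) (lower_facet i t).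
Proof. exact: subblock_equiv. Qed.

Lemma upper_equiv i s t : bequiv s t -> bequiv (upper_facet i s) (upper_facet i t).
Proof. exact: subblock_equiv. Qed.

Definition facet (e : bool) i s := if e then upper_facet i s else lower_facet i s.

Lemma facet_equiv e i s t : bequiv s t -> bequiv (facet e i s) (facet e i t).
Proof. by case: e; [apply: upper_equiv | apply: lower_equiv]. Qed.

Lemma facet_ext e t a x i : facet e i (Ext t a x) =
  if i == (dim t).+1 then bcat t (if e then a :: x else x) else Ext (facet e i t) a x.
Proof. by case: e; rewrite /= ?upper_ext ?lower_ext. Qed.

Lemma facet_bcat e i t x : (i <= dim t)%N -> facet e i (bcat t x) = bcat (facet e i t) x.
Proof.
case: t => [y|t a y]; first by case: i e => [|i] [].
move=> it; rewrite [bcat _ _]/= !facet_ext; case: ifP => //= _.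
by case: e; rewrite bcat_cat.
Qed.

Lemma dim_facetE e i s : (0 < i <= dim s)%N -> dim (facet e i s) = (dim s).-1.
Proof. by case: e => si; rewrite ?dim_upper ?dim_lower. Qed.

Lemma facet_facet e e' i j s : (0 < j < i)%N -> (i <= dim s)%N ->
  facet e' j (facet e i s) = facet e i.-1 (facet e' j s).
Proof.
elim: s => [x|t IHt a x]; first by case: i => [|i]; rewrite ?andbF ?ltn0.
move=> ji; rewrite [dim _]/= => it; rewrite !facet_ext.
have jt : (j <= dim t)%N by lia.
have -> : (j == (dim t).+1) = false by lia.
rewrite facet_ext; have -> : dim (facet e' j t) = (dim t).-1 by rewrite dim_facetE //; lia.
case: eqVneq => [->|ne].
  have -> : (dim t).+1.-1 == (dim t).-1.+1 by lia.
  by rewrite facet_bcat.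
have -> : (i.-1 == (dim t).-1.+1) = false by lia.
rewrite facet_ext dim_facetE; last by lia.
have -> : (j == (dim t).-1.+1) = false by lia.
by rewrite IHt //; lia.
Qed.

(** Two consecutive edges inserting the same letter at the same place. *)
Definition twin j s := (0 < j < dim s)%N /\
  forall e, bequiv (facet e j s) (facet e j.+1 s).

Lemma twin_facet e i j s : twin j s -> (0 < i <= dim s)%N -> i != j -> i != j.+1 ->
  exists j', twin j' (facet e i s).
Proof.
move=> [js tj] si ij ij1; have [lt|ge] := ltnP i j.
  exists j.-1; split=> [|b]; first by rewrite dim_facetE //; lia.
  have -> : j.-1.+1 = j.+1.-1 by lia.
  rewrite -!facet_facet; try lia.
  exact: facet_equiv.
exists j; split=> [|b]; first by rewrite dim_facetE //; lia.
rewrite (@facet_facet e b i j) ?(@facet_facet e b i j.+1); try lia.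
exact: facet_equiv.
Qed.

(** In a canonical separated block the deletions at two edges differ, whereas
    twin edges give the same deletion. *)
Lemma twin_invalid j s : twin j s -> ~ valid s.
Proof.
move=> [js /(_ false) /= e]; rewrite validE; set c := canon s => gc.
have dc : dim c = dim s := dim_canon s.
have tl i : top (lower_facet i s) = top (lower_facet i c).
  by apply/top_equiv/lower_equiv; rewrite bequiv_sym canon_equiv.
have := top_equiv e; rewrite !tl !top_lower; try lia.
move=> {}e; have [i1 i2] : (0 < j <= dim c)%N /\ (0 < j.+1 <= dim c)%N by lia.
have /allP gm : all (rend (top c)) (marks c) by rewrite -goodE.
have /(pos_inj i1 i2) : pos c j = pos c j.+1.
  by apply: del_inj e; apply: gm; apply: pos_in.
lia.
Qed.

Lemma bequiv_ext s t a x : bequiv s t -> bequiv (Ext s a x) (Ext t a x).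
Proof.
move=> /bequivP[d e]; apply/bequivP; split=> [|I] /=; first by rewrite d.
by rewrite !vertexE d e.
Qed.

Lemma not_separated_twin s : canonical s -> ~~ separated s -> exists j, twin j s.
Proof.
elim: s => [x|t IHt b x] // /= /andP[ct xb].
have sub : ~~ separated t -> exists j, twin j (Ext t b x).
  move=> st; have [j [js tj]] := IHt ct st; exists j.
  split=> [|e]; first by rewrite /=; lia.
  rewrite !facet_ext; have -> : (j == (dim t).+1) = false by lia.
  have -> : (j.+1 == (dim t).+1) = false by lia.
  exact: bequiv_ext.
case: t {IHt} ct sub => [y|t a y] // ct sub.
case: (boolP (separated (Ext t a y))) sub => [st _|_ sub _]; last exact: sub.
rewrite /= negb_imply negbK => /andP[/eqP -> /eqP ->].
exists (dim t).+1; split=> [|e]; first by rewrite /=; lia.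
rewrite !facet_ext !eqxx.
have -> : ((dim t).+1 == (dim (Ext t b [::])).+1) = false by rewrite /=; lia.
case: e => /=; last first.
  by case: (t) => [z|u c z] /=; rewrite cats0; apply: bequiv_refl.
apply/bequivP; split=> [|I]; first by rewrite /= dim_bcat.
rewrite !vertexE vertex_bcat dim_bcat -!catA.
by case: ifP => //=; rewrite cats0.
Qed.

Notation bchain := {freeg (block A) / int}.

(** The class of s in the chain complex, as a canonical block, or 0 if s is not
    valid. *)
Definition nu s : bchain := if separated (canon s) then << canon s >> else 0.

Definition bdry_block s : bchain :=
  \sum_(1 <= i < (dim s).+1) (-1) ^+ i.+1 *:
    (nu (upper_facet i s) - nu (lower_facet i s)).

Definition bdry : bchain -> bchain := fglift bdry_block.

Lemma bdry_additive : zmod_morphism bdry.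
Proof. exact: lift_is_additive. Qed.

HB.instance Definition _ :=
  GRing.isZmodMorphism.Build bchain bchain bdry bdry_additive.

Lemma bdry_basis s : bdry << s >> = bdry_block s.
Proof. by rewrite /bdry liftU scale1r. Qed.

Lemma nu_equiv s t : bequiv s t -> nu s = nu t.
Proof. by rewrite /nu => /canon_eq ->. Qed.

Lemma nu_invalid s : ~ valid s -> nu s = 0.
Proof. by rewrite validE good_canon /nu; case: separated => // /(_ isT). Qed.

Lemma bdry_block_equiv s t : bequiv s t -> bdry_block s = bdry_block t.
Proof.
move=> st; rewrite /bdry_block (dim_equiv st); apply: eq_bigr => i _.
by rewrite (nu_equiv (upper_equiv i st)) (nu_equiv (lower_equiv i st)).
Qed.

Lemma bdry_block_twin j s : twin j s -> bdry_block s = 0.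
Proof.
move=> tj; have [js ej] := tj.
have n0 i e : (0 < i <= dim s)%N -> i != j -> i != j.+1 -> nu (facet e i s) = 0.
  move=> si ij ij1; have [j' tj'] := twin_facet e tj si ij ij1.
  exact/nu_invalid/(twin_invalid tj').
rewrite /bdry_block (big_cat_nat (n := j)) /=; try lia.
rewrite (big_ltn (m := j)) ?(big_ltn (m := j.+1)); try lia.
rewrite [X in X + _]big_nat_cond big1; last first.
  move=> i /andP[si _]; rewrite (n0 i true) ?(n0 i false) ?subrr ?scaler0 //; lia.
rewrite [X in _ + (_ + (_ + X))]big_nat_cond [X in _ + (_ + (_ + X))]big1; last first.
  move=> i /andP[si _]; rewrite (n0 i true) ?(n0 i false) ?subrr ?scaler0 //; lia.
have -> : nu (upper_facet j.+1 s) = nu (upper_facet j s) by apply/esym/nu_equiv/(ej true).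
have -> : nu (lower_facet j.+1 s) = nu (lower_facet j s) by apply/esym/nu_equiv/(ej false).
by rewrite addr0 add0r -scalerDl [_ ^+ j.+2]exprS mulN1r subrr scale0r.
Qed.

(** An invalid block contributes nothing, and the facets of an invalid block
    cancel as well: its two twin edges give pairs of equal facets with opposite
    signs, and all its other facets keep the twin edges. *)
Lemma bdry_nu s : bdry (nu s) = bdry_block s.
Proof.
rewrite (bdry_block_equiv (t := canon s)); last by rewrite bequiv_sym canon_equiv.
rewrite /nu; case: (boolP (separated _)) => [_|ns]; first by rewrite bdry_basis.
have [j tj] := not_separated_twin (canonical_canon s) ns.
by rewrite raddf0 (bdry_block_twin tj).
Qed.

Lemma bdryZ c x : bdry (c *: x) = c *: bdry x.
Proof. by rewrite -[c]intz !scaler_int raddfMz. Qed.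

Lemma bdryB x y : bdry (x - y) = bdry x - bdry y.
Proof. exact: raddfB. Qed.

(** The cancellation behind the vanishing of the square of a boundary given by
    facets that commute up to a shift of indices. *)
Lemma alternating_sum (V : zmodType) (a : nat -> nat -> V) n :
  (forall i j, (0 < j < i)%N -> (i <= n.+1)%N -> a i j = - a j i.-1) ->
  \sum_(1 <= i < n.+2) \sum_(1 <= j < n.+1) a i j = 0.
Proof.
elim: n => [|n IHn] ha; first by rewrite big_nat1 big_geq.
rewrite big_nat_recr //=.
under eq_bigr => i _ do rewrite big_nat_recr //=.
rewrite big_split /= IHn ?add0r; last by move=> i j ji it; apply: ha => //; lia.
rewrite -big_split big_nat_cond big1 //= => i /andP[it _].
by rewrite (ha n.+2) ?addrN //; lia.
Qed.

Lemma bdry_bdry_block s : bdry (bdry_block s) = 0.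
Proof.
rewrite {1}/bdry_block raddf_sum.
pose a i j := (-1) ^+ i.+1 *: ((-1) ^+ j.+1 *:
   (nu (facet true j (facet true i s)) - nu (facet false j (facet true i s))
    - (nu (facet true j (facet false i s)) - nu (facet false j (facet false i s))))).
have -> : \sum_(1 <= i < (dim s).+1)
    bdry ((-1) ^+ i.+1 *: (nu (upper_facet i s) - nu (lower_facet i s)))
  = \sum_(1 <= i < (dim s).+1) \sum_(1 <= j < dim s) a i j.
  apply: eq_big_nat => i si; rewrite bdryZ bdryB !bdry_nu /bdry_block.
  have [-> ->] := dim_facet si; rewrite prednK; last by lia.
  by rewrite -sumrB scaler_sumr; apply: eq_bigr => j _; rewrite -scalerBr.
case dn: (dim s) => [|n]; first by rewrite big_geq.
apply: alternating_sum => i j ji it; rewrite /a.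
have ff e e' : facet e' j (facet e i s) = facet e i.-1 (facet e' j s).
  by apply: facet_facet; rewrite ?dn.
rewrite !ff prednK; last by lia.
rewrite !scalerA -!exprD -scaleNr -[X in _ = X *: _]mulN1r -exprS.
have -> : (j.+1 + i).+1 = (i.+1 + j.+1)%N by lia.
by congr (_ *: _); rewrite !opprD !opprK addrACA.
Qed.

Lemma basis_scale (K : choiceType) (c : int) (s : K) :
  << c *g s >> = c *: (<< s >> : {freeg K / int}).
Proof. by apply/eqP/freeg_eqP => t; rewrite coeffZ !coeffU mul1r. Qed.

Lemma bdryE x : bdry x = \sum_(s <- dom x) coeff s x *: bdry_block s.
Proof.
rewrite -{1}[x]freeg_sumE raddf_sum; apply: eq_bigr => s _ /=.
by rewrite basis_scale bdryZ bdry_basis.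
Qed.

Lemma bdry_bdry x : bdry (bdry x) = 0.
Proof.
rewrite [X in bdry X]bdryE raddf_sum big1 // => s _ /=.
by rewrite bdryZ bdry_bdry_block scaler0.
Qed.

(** * Coefficients of the boundary *)

Lemma coeff_nu t s : coeff t (nu s) = ((separated (canon s)) && (canon s == t))%:R.
Proof. by rewrite /nu; case: separated; rewrite ?coeff0 // coeffU mul1r. Qed.

Lemma coeff_bdry t x : coeff t (bdry x) = \sum_(s <- dom x) coeff s x * coeff t (bdry_block s).
Proof. by rewrite bdryE raddf_sum; apply: eq_bigr => s _; rewrite /= coeffZ. Qed.

Lemma coeff_bdry_block t s : coeff t (bdry_block s) =
  \sum_(1 <= i < (dim s).+1) (-1) ^+ i.+1 *
    (coeff t (nu (upper_facet i s)) - coeff t (nu (lower_facet i s))).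
Proof. by rewrite raddf_sum; apply: eq_bigr => i _; rewrite /= coeffZ coeffB. Qed.

Lemma coeff_bdry_neq0 t s : good s -> coeff t (bdry_block s) != 0 ->
  exists2 i, (0 < i <= dim s)%N &
    t = upper_facet i s \/ (good t /\ t = canon (lower_facet i s)).
Proof.
move=> gs; rewrite coeff_bdry_block => nz.
have [i si ne] : exists2 i, (0 < i <= dim s)%N &
    coeff t (nu (upper_facet i s)) - coeff t (nu (lower_facet i s)) != 0.
  apply: contrapT => no; case/negP: nz; rewrite big_nat_cond big1 // => i /andP[si _].
  by apply/eqP; rewrite mulf_eq0; apply/orP; right; apply/negPn/negP => ne; apply: no; exists i.
exists i => //; move: ne; rewrite !coeff_nu canon_good ?good_upper //.
case: (upper_facet i s =P t) => [|_]; first by left.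
rewrite andbF sub0r oppr_eq0.
case: (canon (lower_facet i s) =P t) => [<-|_]; last by rewrite andbF eqxx.
rewrite andbT; case: (boolP (separated _)); rewrite ?eqxx // => sc _.
by right; rewrite good_canon.
Qed.

(** An upper facet is a facet only once: the others have other marks or a
    shorter top word. *)
Lemma coeff_bdry_upper s i : good s -> (0 < i <= dim s)%N ->
  coeff (upper_facet i s) (bdry_block s) = (-1) ^+ i.+1.
Proof.
move=> gs si; rewrite coeff_bdry_block (bigD1_seq i) ?iota_uniq ?mem_index_iota //=.
have low j : (0 < j <= dim s)%N -> coeff (upper_facet i s) (nu (lower_facet j s)) = 0.
  move=> sj; rewrite coeff_nu; case: eqP; rewrite ?andbF // => /(congr1 (fun t => size (top t))).
  rewrite (top_equiv (canon_equiv _)) top_upper; have := size_top_lower sj; lia.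
rewrite low // subr0 coeff_nu canon_good ?good_upper // eqxx.
have -> : separated (upper_facet i s) by have /andP[] := good_upper si gs.
rewrite mulr1 big1_seq ?addr0 // => j /andP[ji]; rewrite mem_index_iota => sj.
rewrite low // subr0 coeff_nu canon_good ?good_upper //.
case: eqP => [e|_]; last by rewrite andbF mulr0.
have := mem_marks_upper (pos s j) sj; rewrite e mem_marks_upper // eqxx pos_in // andbT.
by move/negbFE/eqP/(pos_inj sj si)/eqP; rewrite (negbTE ji).
Qed.

End Boundary.

Notation bchain A := {freeg (block A) / int}.

(** * Recognizing homology groups *)

Section Recognition.
Local Open Scope ring_scope.
Local Open Scope quotient_scope.
Variables (U V W : zmodType) (f : {additive U -> V}) (g : {additive V -> W}).

Let bnd_mod (x y : cycle g) :
  \pi_(homology f g) x = \pi_(homology f g) y <-> exists u, f u = val x - val y.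
Proof.
have e := Quotient.idealrBE (@bnd_pred U V W f g : zmodClosed _) x y.
split=> [/eqP h|[u fu]].
  have : (x - y) \in @bnd_pred U V W f g by rewrite e; exact: h.
  by rewrite unfold_in => /asboolP[u fu]; exists u; rewrite fu raddfB.
apply/eqP; have : (x - y) \in @bnd_pred U V W f g.
  by rewrite unfold_in; apply/asboolP; exists u; rewrite fu raddfB.
by rewrite e.
Qed.

Let val0 : val (0 : cycle g) = 0.
Proof. by []. Qed.

Lemma homology_trivial :
  (forall v, g v = 0 -> exists u, f u = v) -> trivial_group (homology f g).
Proof.
move=> ex x; rewrite -[x]reprK; have zE : 0 = \pi_(homology f g) (0 : cycle g) by rewrite raddf0.
rewrite [RHS]zE; apply/bnd_mod; rewrite val0 subr0.
by apply: ex; apply/eqP; exact: (valP (repr x)).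
Qed.

Lemma homology_int (phi : {additive V -> int}) :
  (forall u, phi (f u) = 0) ->
  (forall v, g v = 0 -> phi v = 0 -> exists u, f u = v) ->
  (exists2 v, g v = 0 & phi v = 1) ->
  iso_int (homology f g).
Proof.
move=> phif phiK [v0 gv0 phi0].
pose h (q : homology f g) : int := phi (val (repr q)).
have hpi x : h (\pi x) = phi (val x).
  have /bnd_mod[u fu] : \pi_(homology f g) (repr (\pi_(homology f g) x)) = \pi x by rewrite reprK.
  by apply/eqP; rewrite -subr_eq0 /h -raddfB -fu phif.
have ha : zmod_morphism h.
  move=> x y; rewrite -[x]reprK -[y]reprK -raddfB !hpi.
  by rewrite !raddfB.
pose hM := GRing.isZmodMorphism.Build _ _ h ha.
pose H : {additive homology f g -> int} := HB.pack h hM.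
have cyc n : ker_pred g (v0 *~ n) by rewrite /ker_pred raddfMz gv0 mul0rz.
exists H.
exists (fun n => \pi_(homology f g) (Sub (v0 *~ n) (cyc n) : cycle g)) => [q|n] /=; last first.
  by rewrite -[LHS]/(h _) hpi SubK raddfMz phi0 intz.
rewrite -[RHS]reprK; apply/bnd_mod; rewrite SubK; apply: phiK.
  by rewrite raddfB raddfMz gv0 mul0rz (eqP (valP (repr q) : _ == 0)) subr0.
by rewrite raddfB raddfMz phi0 intz subrr.
Qed.

Lemma trivial_not_int : trivial_group (homology f g) -> ~ iso_int (homology f g).
Proof.
move=> triv [h [k hk kh]]; have : h (k 1) = h (k 0) by rewrite [k 1]triv [k 0]triv.
by rewrite !kh.
Qed.

End Recognition.

(** * Chains as integer combinations of canonical blocks *)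

Section Transfer.
Local Open Scope ring_scope.
Local Open Scope quotient_scope.
Variables (A : choiceType) (W : {fset seq A}).
Implicit Types (s t : block A) (k : nat).

(** The canonical blocks that represent the k-cells of W. *)
Definition cellb k s :=
  [&& good s, dim s == k & all (mem W) (verts (top s) (marks s))].

Lemma in_CBP s : in_CB W s <-> cellb (dim s) (canon s).
Proof.
rewrite /cellb dim_canon eqxx /=; split=> [[vs sW]|/andP[gs /allP sW]].
  apply/andP; split; first exact/validE.
  by apply/allP => v /mem_verts[I ->]; rewrite (vertex_equiv I (canon_equiv s)); apply: sW.
split=> [|I]; first exact/validE.
rewrite -(vertex_equiv I (canon_equiv s)); apply: sW.
by apply/mem_verts; exists I.
Qed.

Lemma cell_predP k s : cell_pred W k (\pi_(bclass A) s) = cellb k (canon s).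
Proof.
apply/cell_pred_pi/idP => [[<-]|cs]; first by move/in_CBP.
have /and3P[_ /eqP ds _] := cs; rewrite dim_canon in ds.
by split=> //; apply/in_CBP; rewrite ds.
Qed.

Definition rep k (c : cell W k) := canon (repr (val c)).

Lemma rep_cell k (c : cell W k) : cellb k (rep c).
Proof. by rewrite /rep -cell_predP reprK; exact: (valP c). Qed.

Definition to_blocks k : chain W k -> bchain A := fglift (fun c => << rep c >>).

Definition of_blocks k : bchain A -> chain W k := fglift (generator W k).

Lemma to_blocks_additive k : zmod_morphism (@to_blocks k).
Proof. exact: lift_is_additive. Qed.

HB.instance Definition _ k := GRing.isZmodMorphism.Build (chain W k) (bchain A)
  (@to_blocks k) (@to_blocks_additive k).

Lemma of_blocks_additive k : zmod_morphism (@of_blocks k).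
Proof. exact: lift_is_additive. Qed.

HB.instance Definition _ k := GRing.isZmodMorphism.Build (bchain A) (chain W k)
  (@of_blocks k) (@of_blocks_additive k).

Lemma to_blocks_basis k c : @to_blocks k << c >> = << rep c >>.
Proof. by rewrite /to_blocks liftU scale1r. Qed.

Lemma of_blocks_basis k s : @of_blocks k << s >> = generator W k s.
Proof. by rewrite /of_blocks liftU scale1r. Qed.

Lemma generatorE k s : cellb k (canon s) ->
  exists2 c : cell W k, generator W k s = << c >> & rep c = canon s.
Proof.
rewrite -cell_predP => cs; rewrite /generator insubT.
exists (Sub (\pi_(bclass A) s) cs) => //.
have e : bequiv (repr (\pi_(bclass A) s)) s by apply/(eqquotP (bclass A)); rewrite reprK.
exact: canon_eq.
Qed.

Lemma to_blocks_generator k s :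
  to_blocks (generator W k s) = if cellb k (canon s) then << canon s >> else 0.
Proof.
case: ifP => [/generatorE[c -> <-]|ns]; first exact: to_blocks_basis.
by rewrite /generator insubF ?raddf0 // cell_predP.
Qed.

Lemma generator_rep k (c : cell W k) : generator W k (rep c) = << c >>.
Proof.
have e : \pi_(bclass A) (rep c) = val c.
  rewrite -[RHS]reprK.
  have e : bequiv (rep c) (repr (val c)) by exact: canon_equiv.
  by apply/(eqquotP (bclass A)).
by rewrite /generator e valK.
Qed.

Lemma freeg_additive_eq (K : choiceType) (V : zmodType) (f g : {additive {freeg K / int} -> V}) :
  (forall x, f << x >> = g << x >>) -> f =1 g.
Proof.
move=> fg z; rewrite -[z]freeg_sumE !raddf_sum; apply: eq_bigr => x _ /=.
by rewrite basis_scale -[coeff x z]intz !scaler_int !raddfMz fg.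
Qed.

Lemma to_blocksK k : cancel (@to_blocks k) (@of_blocks k).
Proof.
apply: (@freeg_additive_eq _ _ (@of_blocks k \o @to_blocks k) idfun) => c /=.
by rewrite to_blocks_basis of_blocks_basis generator_rep.
Qed.

Definition supp (P : block A -> bool) (x : bchain A) := forall s, coeff s x != 0 -> P s.

Lemma supp_to_blocks k (v : chain W k) : supp (cellb k) (to_blocks v).
Proof.
rewrite -[v]freeg_sumE raddf_sum => s /=; apply: contraNT => ns.
rewrite raddf_sum big1 // => c _ /=.
rewrite basis_scale -[coeff c v]intz !scaler_int !raddfMz /= to_blocks_basis coeffU.
by case: eqP ns => [<-|_ _]; rewrite ?rep_cell ?mulr0 ?mul0rz.
Qed.

Lemma of_blocksK k x : supp (cellb k) x -> to_blocks (@of_blocks k x) = x.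
Proof.
move=> sx; rewrite -{2}[x]freeg_sumE -{1}[x]freeg_sumE !raddf_sum.
rewrite big_seq [RHS]big_seq; apply: eq_bigr => s; rewrite mem_dom => /sx cs /=.
rewrite basis_scale -[coeff s x]intz !scaler_int !raddfMz /=.
rewrite of_blocks_basis to_blocks_generator canon_good ?cs //.
by case/and3P: cs.
Qed.

Lemma to_blocks_facet k e i s : (0 < i <= k)%N -> dim s = k -> in_CB W s ->
  to_blocks (generator W k.-1 (facet e i s)) = nu (facet e i s).
Proof.
move=> ik ds cs; rewrite to_blocks_generator /nu.
suff -> : cellb k.-1 (canon (facet e i s)) = separated (canon (facet e i s)) by [].
apply/idP/idP => [/and3P[/andP[]] //|sf].
have df : dim (facet e i s) = k.-1 by rewrite dim_facetE ds.
rewrite -df -in_CBP; case: e sf {df} => sf; apply: in_CB_subblock => //;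
by apply/validE; rewrite good_canon.
Qed.

Lemma to_blocks_boundary k (v : chain W k) :
  to_blocks (boundary v) = bdry (to_blocks v).
Proof.
apply: (@freeg_additive_eq _ _ (@to_blocks k.-1 \o @boundary A W k)
  (@bdry A \o @to_blocks k)) => c /=.
rewrite to_blocks_basis bdry_basis /boundary liftU scale1r /cell_boundary.
have cs : in_CB W (repr (val c)).
  by have /asboolP[] := valP c.
have ds : dim (repr (val c)) = k by have /asboolP[] := valP c.
rewrite (bdry_block_equiv (canon_equiv _)) /bdry_block ds raddf_sum.
apply: eq_big_nat => i ik /=.
rewrite -[(-1) ^+ i.+1]intz !scaler_int raddfMz raddfB /=.
by rewrite (to_blocks_facet true) ?(to_blocks_facet false).
Qed.

(** ** The homology of W read on combinations of canonical blocks *)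

Lemma ICC_trivial k :
  (forall x, supp (cellb k) x -> bdry x = 0 ->
    exists2 y, supp (cellb k.+1) y & bdry y = x) ->
  forall v : chain W k, boundary v = 0 ->
    exists u : chain W k.+1, boundary u = v.
Proof.
move=> ex v dv; have [|y sy dy] := ex (to_blocks v) (@supp_to_blocks k v).
  by rewrite -to_blocks_boundary dv raddf0.
exists (of_blocks k.+1 y); apply: (can_inj (@to_blocksK k)).
by rewrite -dy -{2}(of_blocksK sy); exact: (@to_blocks_boundary k.+1).
Qed.

Lemma ICC_int k (phi : {additive bchain A -> int}) :
  (forall y, supp (cellb k.+1) y -> phi (bdry y) = 0) ->
  (forall x, supp (cellb k) x -> bdry x = 0 -> phi x = 0 ->
    exists2 y, supp (cellb k.+1) y & bdry y = x) ->
  (exists x, [/\ supp (cellb k) x, bdry x = 0 & phi x = 1]) ->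
  iso_int (ICC_homology W k).
Proof.
move=> phid phiK [g [sg dg phig]].
apply: (@homology_int _ _ _ _ _ (phi \o @to_blocks k)) => [u|v dv|].
- by rewrite /= [X in phi X](@to_blocks_boundary k.+1 u) phid //; apply: supp_to_blocks.
- move=> /= phiv; have [|y sy dy] := phiK _ (@supp_to_blocks k v) _ phiv.
    by rewrite -to_blocks_boundary dv raddf0.
  exists (of_blocks k.+1 y); apply: (can_inj (@to_blocksK k)).
  by rewrite -dy -{2}(of_blocksK sy); exact: (@to_blocks_boundary k.+1).
- exists (of_blocks k g); last by rewrite /= of_blocksK.
  by apply: (can_inj (@to_blocksK k.-1)); rewrite to_blocks_boundary of_blocksK // dg raddf0.
Qed.

Lemma ICC_not_int k :
  (forall x, supp (cellb k) x -> bdry x = 0 ->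
    exists2 y, supp (cellb k.+1) y & bdry y = x) ->
  ~ iso_int (ICC_homology W k).
Proof. by move=> ex; apply/trivial_not_int/homology_trivial/ICC_trivial. Qed.

End Transfer.

(** * Discrete Morse theory on the insertion chain complex *)

Section Morse.
Local Open Scope ring_scope.
Variables (A : choiceType) (W : {fset seq A}).
Implicit Types (s t : block A) (k : nat) (x y z : bchain A).

Local Notation cellb := (cellb W).

Lemma cellb_good k s : cellb k s -> good s. Proof. by case/and3P. Qed.

Lemma cellb_dim k s : cellb k s -> dim s = k. Proof. by case/and3P => _ /eqP. Qed.

Lemma cellb_in_CB s : good s -> in_CB W s <-> cellb (dim s) s.
Proof. by move=> gs; rewrite in_CBP canon_good. Qed.

Lemma cellb_upper k i s : (0 < i <= k.+1)%N -> cellb k.+1 s -> cellb k (upper_facet i s).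
Proof.
move=> ik cs; have gs := cellb_good cs; have ds := cellb_dim cs.
have si : (0 < i <= dim s)%N by rewrite ds.
have := dim_upper si; rewrite ds /= => <-; apply/cellb_in_CB; first exact: good_upper.
rewrite -ds in cs; move/(cellb_in_CB gs): cs => cs; apply: in_CB_subblock => //.
by apply: valid_upper_facet => //; case: cs.
Qed.

Lemma supp_bdry k y : supp (cellb k.+1) y -> supp (cellb k) (bdry y).
Proof.
move=> sy t; rewrite coeff_bdry => nz.
have [s sy' ne] : exists2 s, s \in dom y & coeff t (bdry_block s) != 0.
  apply: contrapT => no; case/negP: nz; rewrite big_seq big1 // => s sy'.
  by apply/eqP; rewrite mulf_eq0; apply/orP; right; apply/negPn/negP => ne; apply: no; exists s.
rewrite mem_dom in sy'; have cs := sy _ sy'.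
have gs := cellb_good cs; have ds := cellb_dim cs.
have [i si [->|[gt et]]] := coeff_bdry_neq0 gs ne.
  by apply: cellb_upper => //; rewrite -ds.
have dt : dim t = k by rewrite et dim_canon dim_lower // ds.
have vl : valid (lower_facet i s) by apply/validE; rewrite -et.
rewrite -dt et dim_canon; apply/in_CBP/in_CB_subblock => //.
by apply/(cellb_in_CB gs); rewrite ds.
Qed.

Lemma suppD (P : block A -> bool) x y : supp P x -> supp P y -> supp P (x + y).
Proof.
move=> sx sy t; rewrite coeffD => ne; case: (boolP (coeff t x == 0)) => [/eqP e|/sx //].
by apply: sy; move: ne; rewrite e add0r.
Qed.

Lemma suppN (P : block A -> bool) x : supp P x -> supp P (- x).
Proof. by move=> sx t; rewrite coeffN oppr_eq0 => /sx. Qed.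

Lemma suppZ (P : block A -> bool) c x : supp P x -> supp P (c *: x).
Proof. by move=> sx t; rewrite coeffZ mulf_eq0 negb_or => /andP[_ /sx]. Qed.

Lemma supp_basis (P : block A -> bool) s : P s -> supp P << s >>.
Proof. by move=> Ps t; rewrite coeffU mul1r; case: (s =P t) => [<-|]. Qed.

Lemma supp0 (P : block A -> bool) : supp P 0.
Proof. by move=> t; rewrite coeff0 eqxx. Qed.

Lemma coeff_ext x y : (forall s, coeff s x = coeff s y) -> x = y.
Proof. by move=> xy; apply/eqP/freeg_eqP. Qed.

(** U selects the cells to be removed together with up s, and ht bounds the
    removals: up s has s as a facet with coefficient 1 or -1, and its other
    facets in U are lower.  The cells outside U and the image of up are critical. *)
Variables (U : pred (block A)) (up dn : block A -> block A) (ht : block A -> nat).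

Hypothesis up_cell : forall k s, cellb k s -> U s -> cellb k.+1 (up s).
Hypothesis up_coeff : forall k s, cellb k s -> U s ->
  coeff s (bdry_block (up s)) * coeff s (bdry_block (up s)) = 1.
Hypothesis up_ht : forall k s s', cellb k s -> U s -> cellb k s' -> U s' -> s' <> s ->
  coeff s' (bdry_block (up s)) != 0 -> (ht s' < ht s)%N.

Definition raised k t := exists s, [/\ cellb k s, U s & t = up s].

(** Subtracting multiples of the boundaries of the cells up s, for s of maximal
    height, removes these s from x and changes only lower cells of U. *)
Lemma sweep k x : supp (cellb k) x ->
  exists y, [/\ supp (cellb k.+1) y, forall t, coeff t y != 0 -> raised k t
    & forall s, coeff s (x - bdry y) != 0 -> ~~ U s].
Proof.
have [N] : exists N, forall s, coeff s x != 0 -> U s -> (ht s < N)%N.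
  exists (\sum_(s <- dom x) (ht s).+1)%N => s; rewrite -mem_dom => sx _.
  by rewrite (big_rem s) //=; lia.
elim: N x => [|N IHN] x hN sx.
  exists 0; split=> [|t|s]; [exact: supp0 | by rewrite coeff0 eqxx|].
  by rewrite raddf0 subr0 => /hN hs; apply/negP => /hs.
pose c s := coeff s x * coeff s (bdry_block (up s)).
pose P s := U s && (ht s == N).
pose y0 : bchain A := \sum_(s <- dom x | P s) c s *: << up s >>.
have domP s : s \in dom x -> cellb k s by rewrite mem_dom => /sx.
have r0 t : coeff t y0 != 0 -> raised k t.
  move=> nz; apply: contrapT => no; case/negP: nz; rewrite raddf_sum big_seq_cond big1 //.
  move=> s /and3P[/domP cs Us _] /=; rewrite coeffZ coeffU mul1r.
  by case: (up s =P t) => [e|_]; [case: no; exists s | rewrite mulr0].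
have s0 : supp (cellb k.+1) y0 by move=> t /r0[s [cs Us ->]]; exact: up_cell.
have b0 s : coeff s (bdry y0) =
    \sum_(s' <- dom x | P s') c s' * coeff s (bdry_block (up s')).
  rewrite /y0 !raddf_sum /=; apply: eq_bigr => s' _.
  by rewrite bdryZ coeffZ bdry_basis.
have s1 : supp (cellb k) (x - bdry y0) by apply: suppD => //; apply/suppN/supp_bdry.
have [|y1 [sy1 ry1 uy1]] := IHN (x - bdry y0) _ s1; last first.
  exists (y0 + y1); split=> [|t|s]; first exact: suppD.
    rewrite coeffD; case: (boolP (coeff t y0 == 0)) => [/eqP ->|/r0 //].
    by rewrite add0r => /ry1.
  have -> : bdry (y0 + y1) = bdry y0 + bdry y1 by exact: raddfD.
  by rewrite opprD addrA; apply: uy1.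
move=> s nz Us; have cs := s1 _ nz; rewrite ltnNge; apply/negP => Ns.
have off s' : s' \in dom x -> P s' -> s' != s ->
    c s' * coeff s (bdry_block (up s')) = 0.
  move=> /domP cs' /andP[Us' /eqP hs'] /eqP ne.
  have [->|nz'] := eqVneq (coeff s (bdry_block (up s'))) 0; first by rewrite mulr0.
  have := up_ht cs' Us' cs Us (fun e => ne (esym e)) nz'; rewrite hs'; lia.
move: nz; rewrite coeffB b0; case: (boolP (s \in dom x)) => sd; last first.
  rewrite coeff_outdom // big_seq_cond big1 ?subrr ?eqxx // => s' /andP[sd' Ps'].
  by apply: off => //; apply: contraNneq sd => <-.
have Ps : P s.
  by rewrite /P Us /= eqn_leq Ns andbT -ltnS; apply: hN => //; rewrite -mem_dom.
rewrite (big_rem s) //= Ps big_seq_cond big1 => [|s' /andP[]]; last first.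
  by rewrite mem_rem_uniq ?uniq_dom // => /andP[ne sd'] Ps'; apply: off.
by rewrite addr0 /c -mulrA (up_coeff cs Us) mulr1 subrr eqxx.
Qed.

Hypothesis dn_cell : forall k t, cellb k.+1 t -> ~~ U t -> raised k t ->
  [/\ cellb k (dn t), U (dn t) & t = up (dn t)].

(** If the height of dn t is maximal among the cells t of z, then dn t is a facet
    of no other cell of z, so its coefficient in the boundary cannot cancel. *)
Lemma raised_cycle k z : supp (cellb k.+1) z ->
  (forall t, coeff t z != 0 -> ~~ U t /\ raised k t) -> bdry z = 0 -> z = 0.
Proof.
move=> sz rz dz; have [z0|nz] := eqVneq z 0 => //.
have dnP t : coeff t z != 0 -> [/\ cellb k (dn t), U (dn t) & t = up (dn t)].
  by move=> nt; have [nU rt] := rz t nt; apply: dn_cell => //; apply: sz.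
have [t tz tmax] : exists2 t, t \in dom z &
    forall t', t' \in dom z -> (ht (dn t') <= ht (dn t))%N.
  have : dom z <> [::] by move/eqP; rewrite dom_eq0 (negbTE nz).
  elim: (dom z) => // t l IHl _; have [->|/eqP /IHl [u ul um]] := eqVneq l [::].
    by exists t; rewrite ?inE // => t'; rewrite inE => /eqP ->.
  have [le|/ltnW le] := leqP (ht (dn u)) (ht (dn t)).
    exists t; rewrite ?inE ?eqxx // => t'; rewrite inE => /predU1P[->//|/um h].
    exact: leq_trans h le.
  by exists u; rewrite ?inE ?ul ?orbT // => t'; rewrite inE => /predU1P[->|/um].
have nt : coeff t z != 0 by rewrite -mem_dom.
have [cd Ud et] := dnP t nt.
have := coeff_bdry (dn t) z; rewrite dz coeff0 (bigD1_seq t) ?uniq_dom //=.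
rewrite big_seq_cond big1 => [|t' /andP[]]; last first.
  rewrite mem_dom => nt' ne; have [cd' Ud' et'] := dnP t' nt'.
  have [->|nz'] := eqVneq (coeff (dn t) (bdry_block t')) 0; first by rewrite mulr0.
  have ned : dn t <> dn t' by move=> e; case/eqP: ne; rewrite et e -et'.
  rewrite et' in nz'; have := up_ht cd' Ud' cd Ud ned nz'.
  by have := tmax t'; rewrite mem_dom nt' => /(_ isT); lia.
rewrite addr0 => /esym /eqP; rewrite mulf_eq0 (negbTE nt) /= => /eqP e0.
by have := up_coeff cd Ud; rewrite -et e0 mulr0 => /eqP.
Qed.

(** A cycle that vanishes on the critical cells is a boundary, as soon as no
    boundary meets these cells. *)
Lemma exact_off_critical k x : supp (cellb k.+1) x -> bdry x = 0 ->
  (forall t, cellb k.+1 t -> ~~ U t -> ~ raised k t ->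
     coeff t x = 0 /\ forall y, supp (cellb k.+2) y -> coeff t (bdry y) = 0) ->
  exists y, [/\ supp (cellb k.+2) y, forall t, coeff t y != 0 -> raised k.+1 t
    & bdry y = x].
Proof.
move=> sx dx crit; have [y [sy ry uy]] := sweep sx; exists y; split=> //.
apply/esym/eqP; rewrite -subr_eq0; apply/eqP/(@raised_cycle k); last first.
- by rewrite bdryB dx bdry_bdry subr0.
- move=> t nt; have nU := uy t nt; split=> //; apply: contrapT => nr.
  have [|x0 /(_ y sy) y0] := crit t _ nU nr; last by move: nt; rewrite coeffB x0 y0 subr0 eqxx.
  by move: nt; apply: suppD => //; apply/suppN/supp_bdry.
- by apply: suppD => //; apply/suppN/supp_bdry.
Qed.

Lemma deg_bdry y : supp (cellb 1) y -> deg (bdry y) = 0.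
Proof.
move=> sy; rewrite bdryE raddf_sum big_seq big1 // => s; rewrite mem_dom => /sy cs /=.
rewrite -[coeff s y]intz !scaler_int raddfMz.
have gs := cellb_good cs; have ds := cellb_dim cs.
have si : (0 < 1 <= dim s)%N by rewrite ds.
rewrite /bdry_block ds big_nat1 sqrrN expr1n scale1r.
suff d1 t : dim t = 0%N -> deg (nu t) = 1.
  by rewrite raddfB /= !d1 ?dim_upper ?dim_lower ?ds // subrr !mul0rz.
move=> dt; have sc : separated (canon t) by move: (canon t) (dim_canon t); rewrite dt => -[].
by rewrite /nu sc degU.
Qed.

Lemma exact_at_vertices v0 x : cellb 0 v0 -> (forall t, cellb 0 t -> U t \/ t = v0) ->
  supp (cellb 0) x -> deg x = 0 ->
  exists y, [/\ supp (cellb 1) y, forall t, coeff t y != 0 -> raised 0 t & bdry y = x].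
Proof.
move=> cv0 only sx dx; have [y [sy ry uy]] := sweep sx; exists y; split=> //.
set z := x - bdry y in uy.
have sz : supp (cellb 0) z by apply: suppD => //; apply/suppN/supp_bdry.
have zE : z = coeff v0 z *: << v0 >>.
  apply: coeff_ext => s; rewrite coeffZ coeffU mul1r.
  case: (v0 =P s) => [->|ne]; first by rewrite mulr1.
  rewrite mulr0; apply/eqP/negPn/negP => ns.
  by have [Us|e] := only s (sz s ns); [have := uy s ns; rewrite Us | apply: ne].
have : deg z = 0 by rewrite /z raddfB /= dx deg_bdry ?subr0.
rewrite zE -[coeff v0 z]intz scaler_int raddfMz /= degU intz => e.
by apply/esym/eqP; rewrite -subr_eq0 -/z zE e scale0r.
Qed.

Lemma point_homology v0 : cellb 0 v0 ->
  (forall t, cellb 0 t -> U t \/ t = v0) -> iso_int (ICC_homology W 0).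
Proof.
move=> cv0 only; apply: (@ICC_int _ _ _ (@deg _)); first exact: deg_bdry.
- by move=> x sx _ /(exact_at_vertices cv0 only sx)[y [sy _ dy]]; exists y.
- exists << v0 >>; split; [exact: supp_basis | | exact: degU].
  by rewrite bdry_basis /bdry_block (cellb_dim cv0) big_geq.
Qed.

Lemma trivial_homology_degree k : (forall t, cellb k.+1 t -> U t \/ raised k t) ->
  trivial_group (ICC_homology W k.+1).
Proof.
move=> nocrit; apply/homology_trivial/ICC_trivial => x sx dx.
have [|y [sy _ <-]] := exact_off_critical sx dx; last by exists y.
by move=> t /nocrit[-> //|].
Qed.

(** The boundary of the critical cell c is itself a boundary of raised cells,
    which yields a cycle with coefficient 1 at c; this coefficient is the
    isomorphism with the integers. *)
Lemma critical_homology k c : cellb k.+1 c ->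
  (forall t, cellb k.+1 t -> [\/ U t, raised k t | t = c]) ->
  (forall t, cellb k.+2 t -> coeff c (bdry_block t) = 0) ->
  ~ raised k c ->
  (forall t, cellb k t -> [\/ U t, (0 < k)%N /\ raised k.-1 t | k = 0%N]) ->
  (k = 0%N -> exists2 v0, cellb 0 v0 & forall t, cellb 0 t -> U t \/ t = v0) ->
  iso_int (ICC_homology W k.+1).
Proof.
move=> cc only cfree nrc nocrit base.
have bc y : supp (cellb k.+2) y -> coeff c (bdry y) = 0.
  move=> sy; rewrite coeff_bdry big_seq big1 // => t; rewrite mem_dom => /sy /cfree ->.
  by rewrite mulr0.
apply: (@ICC_int _ _ _ (@coeff _ _ c)) => [y /bc //|x sx dx x0|].
  have [|y [sy _ <-]] := exact_off_critical sx dx; last by exists y.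
  by move=> t ct nU nr; have [/(negP nU)|/nr|->] := only t ct.
have sb : supp (cellb k) (bdry << c >>) by apply/supp_bdry/supp_basis.
suff [y [sy ry dy]] : exists y, [/\ supp (cellb k.+1) y,
    forall t, coeff t y != 0 -> raised k t & bdry y = bdry << c >>].
  exists (<< c >> - y); split; first by apply: suppD; [exact: supp_basis | exact: suppN].
    by rewrite bdryB dy subrr.
  rewrite /= coeffB coeffU eqxx mulr1; case: (boolP (coeff c y == 0)) => [/eqP ->|/ry //].
  by rewrite subr0.
case: k cc only cfree nrc nocrit base bc sb => [|k] cc only cfree nrc nocrit base bc sb.
  have [v0 cv0 only0] := base erefl.
  by apply: (exact_at_vertices cv0 only0 sb); apply/deg_bdry/supp_basis.
have [|y [sy ry dy]] := exact_off_critical sb (bdry_bdry _); last by exists y.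
by move=> t ct nU nr; have [/(negP nU)|[_ /nr]|] := nocrit t ct.
Qed.

End Morse.

(** ** Spheres from matchings with two critical cells *)

Section SphereMatching.
Local Open Scope ring_scope.
Variables (A : finType) (W : {fset seq A}).
Variables (U : pred (block A)) (up dn : block A -> block A) (ht : block A -> nat).
Variables (v0 : block A).

Hypothesis up_cell : forall k s, cellb W k s -> U s -> cellb W k.+1 (up s).
Hypothesis up_coeff : forall k s, cellb W k s -> U s ->
  coeff s (bdry_block (up s)) * coeff s (bdry_block (up s)) = 1.
Hypothesis up_ht : forall k s s', cellb W k s -> U s -> cellb W k s' -> U s' -> s' <> s ->
  coeff s' (bdry_block (up s)) != 0 -> (ht s' < ht s)%N.
Hypothesis dn_cell : forall k t, cellb W k.+1 t -> ~~ U t -> raised W U up k t ->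
  [/\ cellb W k (dn t), U (dn t) & t = up (dn t)].
Hypothesis v0_cell : cellb W 0 v0.

Lemma sphere_of_matching k c : cellb W k.+1 c ->
  (forall i t, cellb W i t ->
     [\/ U t, (0 < i)%N /\ raised W U up i.-1 t, t = v0 | t = c]) ->
  (forall t, cellb W k.+2 t -> coeff c (bdry_block t) = 0) ->
  ~ raised W U up k c ->
  sphere_homology W k.+1.
Proof.
move=> cc cls cfree nrc.
have diff i j s t : cellb W i s -> cellb W j t -> s = t -> i = j.
  by move=> /cellb_dim <- /cellb_dim <- ->.
have vert t : cellb W 0 t -> U t \/ t = v0.
  move=> ct; have [Ut|[]//|e|e] := cls _ _ ct; [by left|by right|].
  by have := diff _ _ _ _ ct cc e.
split=> [i [->|->]|[//|i] _ ik].
- exact: (@point_homology _ _ U up ht up_cell up_coeff up_ht v0).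
- apply: (@critical_homology _ _ U up dn ht up_cell up_coeff up_ht dn_cell k c) => //.
  + move=> t ct; have [Ut|[_ rt]|e|e] := cls _ _ ct; [exact: Or31 | exact: Or32| |exact: Or33].
    by have := diff _ _ _ _ ct v0_cell e.
  + move=> t ct; have [Ut|rt|e|e] := cls _ _ ct; [exact: Or31 | exact: Or32 | |].
      by apply: Or33; apply: diff ct v0_cell e.
    by have /eqP := diff _ _ _ _ ct cc e; rewrite ltn_eqF.
  + by move=> _; exists v0.
- apply: (@trivial_homology_degree _ _ U up dn ht up_cell up_coeff up_ht dn_cell).
  move=> t ct; have [Ut|[_ rt]|e|e] := cls _ _ ct; [by left | by right | |].
    by have := diff _ _ _ _ ct v0_cell e.
  by case: ik; apply: diff ct cc e.
Qed.

Lemma point_of_matching :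
  (forall i t, cellb W i t -> [\/ U t, (0 < i)%N /\ raised W U up i.-1 t | t = v0]) ->
  sphere_homology W 0.
Proof.
move=> cls; split=> [i i0|[//|i] _ _].
  have -> : i = 0%N by case: i0.
  apply: (@point_homology _ _ U up ht up_cell up_coeff up_ht v0) => // t ct.
  by have [Ut|[]//|e] := cls _ _ ct; [left|right].
apply: (@trivial_homology_degree _ _ U up dn ht up_cell up_coeff up_ht dn_cell).
move=> t ct; have [Ut|[_ rt]|e] := cls _ _ ct; [by left | by right |].
by move/cellb_dim: ct; rewrite e (cellb_dim v0_cell).
Qed.

End SphereMatching.

(** ** Matchings given by a finite list *)

Section Lists.
Variable A : finType.
Implicit Types (w : seq A) (s t : block A) (ws : seq (seq A)).

Fixpoint sublists (T : Type) (l : seq T) : seq (seq T) :=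
  if l is x :: l' then sublists l' ++ map (cons x) (sublists l') else [:: [::]].

Lemma filter_sublists (l : seq nat) (P : pred nat) : filter P l \in sublists l.
Proof.
elim: l => //= p l IH; rewrite mem_cat; case: (P p); rewrite ?IH //.
by apply/orP; right; apply/mapP; exists (filter P l).
Qed.

Definition marked w (ps : seq nat) := mk w (mem ps).

Definition blocks_over w : seq (block A) :=
  [seq marked w ps | ps <- sublists (filter (rend w) (iota 0 (size w)))].

Definition cells ws : seq (block A) :=
  [seq s <- flatten (map blocks_over ws) |
    good s && all (mem ws) (verts (top s) (marks s))].

Definition words ws : {fset seq A} := [fset w in ws]%fset.

Lemma mem_cells ws k s : cellb (words ws) k s = (s \in cells ws) && (dim s == k).
Proof.
have wsE : all (mem (words ws)) =1 all (mem ws).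
  by move=> l; apply: eq_all => w; rewrite /= in_fset.
rewrite /cellb mem_filter wsE; case: (boolP (good s)) => //= gs.
case: (boolP (all _ _)) => [/allP sW|_] /=; last by rewrite andbF.
rewrite andbT; suff -> : s \in flatten (map blocks_over ws) by [].
apply/flattenP; exists (blocks_over (top s)).
  by apply: map_f; apply: sW; apply: top_verts.
pose l := filter (rend (top s)) (iota 0 (size (top s))).
apply/mapP; exists (filter (mem (marks s)) l); first exact: filter_sublists.
apply: marks_eq; rewrite /marked ?top_mk // => p; rewrite mem_marks_mk /= mem_filter /l.
rewrite mem_filter mem_iota /= add0n; case: (boolP (p \in marks s)) => ps; rewrite ?andbF //.
by move: gs; rewrite goodE => /allP /(_ p ps) ->; rewrite (marks_lt ps).
Qed.

(** A form of the boundary coefficients that evaluates. *)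
Definition incidence t s : int := foldr (fun i n => (-1) ^+ i.+1 *
    ((separated (canon (upper_facet i s)) && (canon (upper_facet i s) == t))%:R
     - (separated (canon (lower_facet i s)) && (canon (lower_facet i s) == t))%:R) + n)%R 0%R
  (iota 1 (dim s)).

Lemma incidenceE t s : coeff t (bdry_block s) = incidence t s.
Proof.
rewrite coeff_bdry_block /incidence unlock /index_iota subSS subn0.
by elim: (iota 1 (dim s)) => //= i l ->; rewrite !coeff_nu.
Qed.

Implicit Types (m : seq (block A * block A * nat)).

(** An entry (s, t, h) of m pairs the cell s, of height h, with the cell t. *)
Definition paired m s := s \in [seq x.1.1 | x <- m].
Definition partner m s := nth s [seq x.1.2 | x <- m] (index s [seq x.1.1 | x <- m]).
Definition copartner m t := nth t [seq x.1.1 | x <- m] (index t [seq x.1.2 | x <- m]).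
Definition height m s := nth 0 [seq x.2 | x <- m] (index s [seq x.1.1 | x <- m]).

Definition check_matching ws m v0 (c : pred (block A)) := [&&
  all (fun s => paired m s ==> [&& partner m s \in cells ws, dim (partner m s) == (dim s).+1,
      ~~ c (partner m s), (incidence s (partner m s) * incidence s (partner m s) == (1 : int))%R
    & all (fun s' => [&& paired m s', s' != s & incidence s' (partner m s) != 0%R] ==>
       (height m s' < height m s)) (cells ws)]) (cells ws),
  v0 \in cells ws, dim v0 == 0 &
  all (fun t => [|| paired m t, t == v0, c t |
     [&& paired m (copartner m t), copartner m t \in cells ws & t == partner m (copartner m t)]])
    (cells ws)].

Section Check.
Variables (ws : seq (seq A)) (m : seq (block A * block A * nat)).
Variables (v0 : block A) (c : pred (block A)).
Hypothesis check : check_matching ws m v0 c.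

Local Notation cellb := (cellb (words ws)).
Local Notation raised := (raised (words ws) (paired m) (partner m)).

Let cell_in k s : cellb k s -> s \in cells ws /\ dim s = k.
Proof. by rewrite mem_cells => /andP[-> /eqP]. Qed.

Let up_check k s : cellb k s -> paired m s -> [/\ cellb k.+1 (partner m s),
  ~~ c (partner m s), (incidence s (partner m s) * incidence s (partner m s) = 1)%R
  & forall s', s' \in cells ws -> [&& paired m s', s' != s & incidence s' (partner m s) != 0%R] ->
       (height m s' < height m s)].
Proof.
case/cell_in => sin ds ps; case/and4P: check => /allP /(_ s sin); rewrite ps /=.
case/and5P => pin dp nc /eqP inc /allP hts _ _ _; split=> //.
  by rewrite mem_cells pin (eqP dp) ds eqxx.
by move=> s' /hts /implyP.
Qed.

Lemma check_up_cell k s : cellb k s -> paired m s -> cellb k.+1 (partner m s).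
Proof. by move=> cs ps; have [] := up_check cs ps. Qed.

Lemma check_up_coeff k s : cellb k s -> paired m s ->
  (coeff s (bdry_block (partner m s)) * coeff s (bdry_block (partner m s)) = 1)%R.
Proof. by move=> cs ps; rewrite !incidenceE; have [] := up_check cs ps. Qed.

Lemma check_up_ht k s s' : cellb k s -> paired m s -> cellb k s' -> paired m s' -> s' <> s ->
  (coeff s' (bdry_block (partner m s)) != 0)%R -> (height m s' < height m s).
Proof.
move=> cs ps /cell_in[s'in _] ps' /eqP ne; rewrite incidenceE => nz.
by have [_ _ _ hts] := up_check cs ps; apply: hts => //; rewrite ps' ne.
Qed.

Lemma check_raised k s : raised k s -> ~~ c s.
Proof. by move=> [s' [cs' ps' ->]]; have [] := up_check cs' ps'. Qed.

Let copartner_cell k t : cellb k t -> paired m (copartner m t) -> copartner m t \in cells ws ->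
  t = partner m (copartner m t) -> exists2 i, k = i.+1 & cellb i (copartner m t).
Proof.
move=> ct pt tin tE; have cd : cellb (dim (copartner m t)) (copartner m t).
  by rewrite mem_cells tin eqxx.
exists (dim (copartner m t)) => //.
by have [cu _ _ _] := up_check cd pt; rewrite -tE in cu; rewrite -(cellb_dim ct) (cellb_dim cu).
Qed.

Lemma check_cell k t : cellb k t -> [\/ paired m t, t = v0, c t |
  [/\ paired m (copartner m t), copartner m t \in cells ws & t = partner m (copartner m t)]].
Proof.
case/cell_in => tin _; case/and4P: check => _ _ _ /allP /(_ t tin).
case/or4P => [pt|/eqP e|ct|/and3P[pt dt /eqP e]]; [exact: Or41|exact: Or42|exact: Or43|exact: Or44].
Qed.

Lemma check_v0 : cellb 0 v0.
Proof. by case/and4P: check => _ vin dv _; rewrite mem_cells vin. Qed.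

Lemma check_dn_cell k t : cellb k.+1 t -> ~~ paired m t -> raised k t ->
  [/\ cellb k (copartner m t), paired m (copartner m t) & t = partner m (copartner m t)].
Proof.
move=> ct nt rt; have [pt|e|cc|[pt tin e]] := check_cell ct; first by rewrite pt in nt.
- by have := cellb_dim check_v0; rewrite -e (cellb_dim ct).
- by have := check_raised rt; rewrite cc.
- by have [i [ki] ci] := copartner_cell ct pt tin e; rewrite ki.
Qed.

Lemma check_class k t : cellb k t -> [\/ paired m t, 0 < k /\ raised k.-1 t, t = v0 | c t].
Proof.
move=> ct; have [pt|e|cc|[pt tin e]] := check_cell ct; [exact: Or41|exact: Or43|exact: Or44|].
have [i ki ci] := copartner_cell ct pt tin e; apply: Or42; rewrite ki; split=> //.
by exists (copartner m t).
Qed.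

End Check.

Lemma sphere_of_list ws m v0 c k : check_matching ws m v0 (pred1 c) ->
  [&& c \in cells ws, dim c == k.+1 & all (fun t => dim t <= k.+1) (cells ws)] ->
  sphere_homology (words ws) k.+1.
Proof.
move=> ck /and3P[cin /eqP dc /allP small].
apply: (sphere_of_matching (check_up_cell ck) (check_up_coeff ck) (check_up_ht ck)
  (check_dn_cell ck) (check_v0 ck) (c := c)).
- by rewrite mem_cells cin dc eqxx.
- move=> i t /(check_class ck)[pt|rt|e|/eqP e]; [exact: Or41|exact: Or42| |exact: Or44].
  exact: Or43.
- by move=> t; rewrite mem_cells => /andP[/small le /eqP dt]; rewrite dt ltnn in le.
- by move/(check_raised ck); rewrite /= eqxx.
Qed.

Lemma point_of_list ws m v0 : check_matching ws m v0 pred0 -> sphere_homology (words ws) 0.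
Proof.
move=> ck; apply: (point_of_matching (check_up_cell ck) (check_up_coeff ck) (check_up_ht ck)
  (check_dn_cell ck) (check_v0 ck)).
by move=> i t /(check_class ck)[pt|rt|e|//]; [exact: Or31|exact: Or32|exact: Or33].
Qed.

End Lists.

(** ** The spheres of dimension at most two *)

Section SmallSpheres.

Local Notation a := false.
Local Notation b := true.

Lemma point_sphere : sphere_homology (words [:: [::] : seq bool]) 0.
Proof. by apply: (@point_of_list _ _ [::] (Word [::])); vm_compute. Qed.

(** Of these words only b lies below ab and ba, and the square with top word
    bab that contains both would have a as its bottom. *)
Definition circle_words := [:: [:: b]; [:: a; b]; [:: b; a]; [:: b; a; b]].

Lemma circle : sphere_homology (words circle_words) 1.
Proof.
pose ab := [:: a; b]; pose ba := [:: b; a]; pose bab := [:: b; a; b].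
pose m := [:: (Word ab, marked ab [:: 0], 0); (Word ba, marked ba [:: 1], 0);
  (Word bab, marked bab [:: 0], 1)].
by apply: (@sphere_of_list _ _ m (Word [:: b]) (marked bab [:: 2])); vm_compute.
Qed.

(** The words aba and bab are the tops of two hemispheres, each made of three
    squares, that meet along the cycle through a, ab, b and ba. *)
Definition sphere_words := [:: [:: a]; [:: b]; [:: a; a]; [:: a; b]; [:: b; a]; [:: b; b];
  [:: a; b; a]; [:: b; a; b]].

Lemma sphere : sphere_homology (words sphere_words) 2.
Proof.
pose ab := [:: a; b]; pose ba := [:: b; a]; pose aa := [:: a; a]; pose bb := [:: b; b].
pose aba := [:: a; b; a]; pose bab := [:: b; a; b].
pose m := [:: (Word ab, marked ab [:: 1], 0); (Word ba, marked ba [:: 0], 0);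
  (Word aa, marked aa [:: 1], 0); (Word [:: b], marked ab [:: 0], 1);
  (Word aba, marked aba [:: 1], 1); (Word bb, marked bb [:: 1], 2);
  (Word bab, marked bab [:: 1], 3);
  (marked aba [:: 0], marked aba [:: 0; 1], 0); (marked aba [:: 2], marked aba [:: 1; 2], 0);
  (marked ba [:: 1], marked aba [:: 0; 2], 1);
  (marked bab [:: 0], marked bab [:: 0; 1], 2); (marked bab [:: 2], marked bab [:: 1; 2], 2)].
by apply: (@sphere_of_list _ _ m (Word [:: a]) (marked bab [:: 0; 2])); vm_compute.
Qed.

Lemma card_words (A : finType) (ws : seq (seq A)) : uniq ws -> #|` words ws| = size ws.
Proof. by move=> uw; rewrite /words card_fseq undup_id. Qed.

End SmallSpheres.

(** * The boundary of a subdivided cube *)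

Section LastOccurrence.
Variable A : choiceType.
Implicit Types (w u v : seq A).

Definition lastpos w l := size w - (index l (rev w)).+1.

Lemma lastpos_cat u l v : l \notin v -> lastpos (u ++ l :: v) l = size u.
Proof.
move=> lv; rewrite /lastpos rev_cat rev_cons -cats1 -catA /= index_cat mem_rev (negbTE lv).
by rewrite /= eqxx addn0 size_rev size_cat /= addnS subSS addnK.
Qed.

Lemma last_split w l : l \in w -> exists u v, w = u ++ l :: v /\ l \notin v.
Proof.
elim: w => // a w IHw; rewrite inE; case: (boolP (l \in w)) => [/IHw[u [v [-> lv]]] _|lw].
  by exists (a :: u), v.
by rewrite orbF => /eqP <-; exists [::], w.
Qed.

Lemma lastpos_rend w l : l \in w -> rend w (lastpos w l).
Proof.
move=> /last_split[u [v [-> lv]]]; rewrite lastpos_cat // rend_mid.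
by case: v lv => // c v; rewrite inE negb_or eq_sym => /andP[/eqP lc _]; apply/eqP => -[].
Qed.

Lemma nth_lastpos d w l : l \in w -> nth d w (lastpos w l) = l.
Proof.
by move=> /last_split[u [v [-> lv]]]; rewrite lastpos_cat // nth_cat ltnn subnn.
Qed.

(** Removing the mark p from a list of marks changes the vertices only by the
    letter at p. *)
Lemma verts_rem d w ms p v : sorted gtn ms -> all (fun q => q < size w) ms -> p \in ms ->
  v \in verts w ms -> v \in verts w (rem p ms) \/
    exists2 v', v' \in verts w (rem p ms) & perm_eq v' (nth d w p :: v).
Proof.
have gtnT : transitive gtn by move=> ? ? ? h1 h2; apply: ltn_trans h1.
elim: ms w v => [|q ms IH] w v //=; rewrite path_sortedE // => /andP[/allP qm sm] /andP[qw mw].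
rewrite inE mem_cat; have [e|ne] /= := eqVneq p q.
  subst q => _ /orP[vm|vm]; [by left|right].
  have wE : w = take p w ++ nth d w p :: drop p.+1 w by rewrite -drop_nth // cat_take_drop.
  have su : size (take p w) = p by rewrite size_takel // ltnW.
  have ub : all (fun q => q < size (take p w)) ms by rewrite su; apply/allP.
  have := vm; rewrite /del verts_catl // => /mapP[y yv ->].
  exists (y ++ nth d w p :: drop p.+1 w).
    by rewrite [X in verts X]wE verts_catl //; apply: map_f.
  by rewrite -cat1s perm_catCA.
move=> pms /orP[vm|vm].
  have [vr|[v' vr pe]] := IH w v sm mw pms vm; [left|right; exists v' => //];
  by rewrite /= mem_cat vr.
have pq : p < q by apply: qm.
have mdw : all (fun q' => q' < size (del q w)) ms.
  by apply/allP => q' /qm /=; rewrite size_del //; lia.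
have nd : nth d (del q w) p = nth d w p.
  by rewrite /del nth_cat size_takel ?(ltnW qw) // pq nth_take.
have [vr|[v' vr]] := IH _ v sm mdw pms vm; [left|rewrite nd => pe; right; exists v' => //];
by rewrite /= mem_cat vr orbT.
Qed.

Lemma bot_letters d (s : block A) : perm_eq (top s) (bot s ++ [seq nth d (top s) p | p <- marks s]).
Proof.
elim: s => [x|t IHt a x]; first by rewrite cats0.
rewrite topE botE /= nth_cat ltnn subnn /=.
have -> : [seq nth d (top t ++ a :: x) p | p <- marks t] = [seq nth d (top t) p | p <- marks t].
  by apply/eq_in_map => p /marks_lt pt; rewrite nth_cat pt.
by apply/permP => P; have := permP IHt P; rewrite !count_cat /= => ->; lia.
Qed.

End LastOccurrence.

Section Grid.
Variable k : nat.
Local Notation letter := 'I_k.+2.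
Implicit Types (w u v : seq letter) (l : letter).

Definition le_letter (l l' : letter) := (l <= l')%N.

Lemma le_letter_trans : transitive le_letter.
Proof. by move=> ? ? ?; apply: leq_trans. Qed.

Lemma le_letter_anti : antisymmetric le_letter.
Proof. by move=> x y h; apply/val_inj/anti_leq. Qed.

Definition power_word (f : letter -> nat) : seq letter :=
  flatten [seq nseq (f l) l | l <- enum letter].

Lemma count_power_word f l : count_mem l (power_word f) = f l.
Proof.
rewrite /power_word count_flatten -map_comp sumnE big_map (bigD1_seq l) ?mem_enum ?enum_uniq //=.
rewrite count_nseq /= eqxx mul1n big1 ?addn0 // => l' ne.
by rewrite count_nseq /= (negbTE ne).
Qed.

Lemma sorted_power_word f : sorted le_letter (power_word f).
Proof.
have letters_sorted : pairwise le_letter (enum letter).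
  rewrite -sorted_pairwise; last exact: le_letter_trans.
  have -> : le_letter = relpre val leq by [].
  by rewrite -sorted_map val_enum_ord iota_sorted.
rewrite sorted_pairwise; last exact: le_letter_trans.
rewrite /power_word; elim: (enum letter) letters_sorted => //= l e IH /andP[/allP le_l /IH pe].
rewrite pairwise_cat pe andbT; apply/andP; split.
  apply/allrelP => x y /nseqP[-> _] /flattenP[s /mapP[l' l'e ->] /nseqP[-> _]].
  exact: le_l.
elim: (f l) => //= n ->; rewrite andbT; apply/allP => x /nseqP[-> _].
exact: leqnn.
Qed.

Lemma sorted_count_eq u v : sorted le_letter u -> sorted le_letter v ->
  (forall l, count_mem l u = count_mem l v) -> u = v.
Proof.
move=> su sv uv; apply: (sorted_eq le_letter_trans le_letter_anti su sv).
by apply/allP => l _; rewrite /= uv.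
Qed.

(** The exponents of u are the coordinates of a lattice point of the cube
    [0, 2]^(k+2) other than its centre. *)
Definition in_grid u := [&& sorted le_letter u, [forall l, count_mem l u <= 2]
  & [exists l, count_mem l u != 1]].

Definition grid : {fset seq letter} :=
  words [seq power_word (fun l => f l) |
    f : {ffun letter -> 'I_3} <- enum (predC1 [ffun=> Ordinal (isT : 1 < 3)])].

Lemma card_grid : #|` grid| <= 3 ^ k.+2 - 1.
Proof.
rewrite /grid /words card_fseq; apply: leq_trans (size_undup _) _.
by rewrite size_map -cardE cardC1 card_ffun !card_ord subn1.
Qed.

Lemma mem_grid u : (u \in grid) = in_grid u.
Proof.
rewrite /grid in_fset; apply/mapP/and3P => [[f]|[su /forallP u2 /existsP[l0 ul0]]].
  rewrite mem_enum inE => /eqP nf ->; split; first exact: sorted_power_word.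
    by apply/forallP => l; rewrite count_power_word -ltnS.
  apply/existsP; apply: contrapT => no; apply: nf; apply/ffunP => l; rewrite ffunE.
  apply/val_inj/eqP; apply: contrapT => /negP fl; apply: no; exists l.
  by rewrite count_power_word.
have cb l : count_mem l u < 3 by rewrite ltnS.
exists [ffun l => Ordinal (cb l)].
  rewrite mem_enum inE; apply/eqP => /ffunP /(_ l0); rewrite !ffunE => /(congr1 val) /= e.
  by rewrite e in ul0.
apply: sorted_count_eq su (sorted_power_word _) _ => l.
by rewrite count_power_word ffunE.
Qed.

Lemma size_count w : size w = \sum_l count_mem l w.
Proof.
elim: w => [|x w IH] /=; first by rewrite big1.
rewrite big_split /= -IH (bigD1 x) //= eqxx big1 => [|l ne].
  by rewrite addn0 add1n.
by rewrite eq_sym (negbTE ne).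
Qed.

Lemma size_const w c : (forall l, count_mem l w = c) -> size w = k.+2 * c.
Proof.
move=> wc; rewrite size_count (eq_bigr (fun=> c)) => [|l _]; last exact: wc.
by rewrite sum_nat_const card_ord.
Qed.

(** In a sorted word every letter forms at most one run. *)
Lemma rend_lastpos w p : sorted le_letter w -> rend w p -> p = lastpos w (nth ord0 w p).
Proof.
move=> sw rp; have pw := rend_size rp.
have wE : w = take p w ++ nth ord0 w p :: drop p.+1 w by rewrite -drop_nth // cat_take_drop.
set x := nth ord0 w p in wE *; set u := take p w in wE *; set v := drop p.+1 w in wE *.
have su : size u = p by rewrite size_takel // ltnW.
rewrite wE lastpos_cat //.
have : sorted le_letter (x :: v).
  by apply: (subseq_sorted le_letter_trans _ sw); rewrite wE suffix_subseq.
have : ohead v != Some x by move: rp; rewrite {1}wE -su rend_mid.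
case: (v) => // y v' /= yx /andP[xy]; rewrite path_sortedE; last exact: le_letter_trans.
move=> /andP[/allP yv _]; rewrite inE negb_or.
have nxy : x != y by apply: contraNneq yx => ->.
rewrite nxy; apply/negP => /yv yx'; move/eqP: nxy; apply.
by apply: le_letter_anti; rewrite xy.
Qed.

Definition run_ends w := filter (rend w) (iota 0 (size w)).

Lemma mem_run_ends w p : (p \in run_ends w) = rend w p.
Proof.
rewrite mem_filter mem_iota /= add0n; case: (boolP (rend w p)) => //= rp.
exact: rend_size.
Qed.

Lemma uniq_run_ends w : uniq (run_ends w).
Proof. exact/filter_uniq/iota_uniq. Qed.

Lemma run_letters_uniq w : sorted le_letter w -> uniq [seq nth ord0 w p | p <- run_ends w].
Proof.
move=> sw; rewrite map_inj_in_uniq ?uniq_run_ends // => p q.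
rewrite !mem_run_ends => rp rq e.
by rewrite (rend_lastpos sw rp) (rend_lastpos sw rq) e.
Qed.

Lemma size_run_ends w : sorted le_letter w -> size (run_ends w) <= k.+2.
Proof.
move=> sw; rewrite -(size_map (nth ord0 w)) -[X in _ <= X](size_enum_ord k.+2).
by apply: uniq_leq_size (run_letters_uniq sw) _ => l _; rewrite mem_enum.
Qed.

Lemma marks_run_ends (s : block letter) : good s -> {subset marks s <= run_ends (top s)}.
Proof. by rewrite goodE => /allP gs p /gs; rewrite mem_run_ends. Qed.

Lemma all_run_ends (s : block letter) : good s -> sorted le_letter (top s) ->
  k.+2 <= dim s -> marks s =i run_ends (top s).
Proof.
move=> gs ss ds; have le := leq_trans (size_run_ends ss) ds; rewrite -size_marks in le.
by have [_] := uniq_min_size (uniq_marks s) (marks_run_ends gs) le.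
Qed.

Definition full_word := power_word (fun=> 2).

Lemma full_word_sorted : sorted le_letter full_word. Proof. exact: sorted_power_word. Qed.

Lemma size_full_word : size full_word = k.+2 * 2.
Proof. by apply: size_const => l; apply: count_power_word. Qed.

Lemma full_word_n0 : full_word != [::].
Proof. by rewrite -size_eq0 size_full_word. Qed.

Lemma size_run_ends_full : size (run_ends full_word) = k.+2.
Proof.
apply/eqP; rewrite eqn_leq (size_run_ends full_word_sorted) /=.
have inw l : l \in full_word by rewrite -has_pred1 has_count count_power_word.
rewrite -{1}(size_enum_ord k.+2) -(size_map (lastpos full_word)).
apply: uniq_leq_size => [|p /mapP[l _ ->]].
  rewrite map_inj_in_uniq ?enum_uniq // => l l' _ _ e.
  by rewrite -(nth_lastpos ord0 (inw l)) e nth_lastpos.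
by rewrite mem_run_ends lastpos_rend.
Qed.

(** ** The matching *)

(** A block with top word w is paired with the block that has one more mark, on
    the last occurrence of the apex letter of w.  The missing word can become a
    vertex only when that letter occurs twice in w, so a letter that occurs once
    is preferred. *)
Definition apex_letter w := if [pick l | count_mem l w == 1] is Some l then l else head ord0 w.

Definition apex w := lastpos w (apex_letter w).

Lemma apex_letter_in w : w != [::] -> apex_letter w \in w.
Proof.
rewrite /apex_letter => wn; case: pickP => [l /eqP l1|_]; first by rewrite -has_pred1 has_count l1.
by case: w wn => // a w _; rewrite mem_head.
Qed.

Lemma apex_rend w : w != [::] -> rend w (apex w).
Proof. by move=> wn; apply/lastpos_rend/apex_letter_in. Qed.

(** The top corner of the cube with every letter but the apex marked: marking the
    apex as well would make the missing word a vertex. *)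
Definition critical := mk full_word (fun p => rend full_word p && (p != apex full_word)).

Definition lower_end (s : block letter) :=
  [&& top s != [::], apex (top s) \notin marks s & s != critical].

Definition add_apex (s : block letter) :=
  mk (top s) (fun p => (p \in marks s) || (p == apex (top s))).

Definition drop_apex (s : block letter) :=
  mk (top s) (fun p => (p \in marks s) && (p != apex (top s))).

Lemma top_add s : top (add_apex s) = top s. Proof. exact: top_mk. Qed.
Lemma top_drop s : top (drop_apex s) = top s. Proof. exact: top_mk. Qed.

Lemma mem_add s p : top s != [::] ->
  (p \in marks (add_apex s)) = (p \in marks s) || (p == apex (top s)).
Proof.
move=> sn; rewrite mem_marks_mk; case: (boolP (p \in marks s)) => [/marks_lt ->//|_] /=.
by case: eqP => [->|_]; rewrite ?andbF // (rend_size (apex_rend sn)).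
Qed.

Lemma mem_drop_apex s p : (p \in marks (drop_apex s)) = (p \in marks s) && (p != apex (top s)).
Proof.
by rewrite mem_marks_mk; case: (boolP (p \in marks s)) => [/marks_lt ->//|_]; rewrite andbF.
Qed.

Lemma good_add s : good s -> top s != [::] -> good (add_apex s).
Proof.
rewrite goodE => /allP gs sn; apply: good_mk => p /orP[/gs //|/eqP ->]; exact: apex_rend.
Qed.

Lemma rem_add s : apex (top s) \notin marks s -> top s != [::] ->
  rem (apex (top s)) (marks (add_apex s)) = marks s.
Proof.
move=> na sn; apply: (irr_sorted_eq (leT := gtn)) => [y z x /= h1 h2|x /=|||p].
- exact: ltn_trans h1.
- by rewrite ltnn.
- apply: subseq_sorted (rem_subseq _ _) (marks_sorted _) => y z x /= h1 h2; exact: ltn_trans h1.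
- exact: marks_sorted.
- rewrite mem_rem_uniq ?uniq_marks // inE mem_add //.
  by case: eqP => [->|_]; rewrite ?orbF // (negbTE na).
Qed.

Lemma dim_add s : apex (top s) \notin marks s -> top s != [::] -> dim (add_apex s) = (dim s).+1.
Proof.
move=> na sn; have ain : apex (top s) \in marks (add_apex s) by rewrite mem_add // eqxx orbT.
rewrite -!size_marks -(rem_add na sn) size_rem // prednK //.
by case: (marks _) ain.
Qed.

Lemma upper_add s : apex (top s) \notin marks s -> top s != [::] ->
  exists2 i, 0 < i <= dim (add_apex s) & s = upper_facet i (add_apex s).
Proof.
move=> na sn; have /pos_ex[i si ip] : apex (top s) \in marks (add_apex s).
  by rewrite mem_add // eqxx orbT.
exists i => //; apply: marks_eq; first by rewrite top_upper top_add.
by move=> p; rewrite marks_upper // ip rem_add.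
Qed.

Lemma drop_add s : apex (top s) \notin marks s -> top s != [::] -> drop_apex (add_apex s) = s.
Proof.
move=> na sn; apply: marks_eq; first by rewrite top_drop top_add.
move=> p; rewrite mem_drop_apex mem_add // top_add.
by case: eqP => [->|_]; rewrite ?andbF ?andbT ?orbF // (negbTE na).
Qed.

Lemma add_drop t : apex (top t) \in marks t -> add_apex (drop_apex t) = t.
Proof.
move=> at_; have tn : top t != [::] by case: (top t) (marks_lt at_).
apply: marks_eq; first by rewrite top_add top_drop.
move=> p; rewrite mem_add ?top_drop // mem_drop_apex.
by case: eqP => [->|_]; rewrite ?andbF ?andbT ?orbF // at_.
Qed.

Local Notation cellb := (cellb grid).

Lemma cell_grid i s : cellb i s ->
  [/\ good s, dim s = i & forall v, v \in verts (top s) (marks s) -> in_grid v].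
Proof.
case/and3P => gs /eqP ds /allP sW; split=> // v /sW; rewrite -mem_grid.
by [].
Qed.

Lemma cell_top i s : cellb i s -> in_grid (top s).
Proof. by move=> /cell_grid[_ _ sW]; apply/sW/top_verts. Qed.

Lemma all_ones_full w v : sorted le_letter w -> (forall l, count_mem l w <= 2) ->
  subseq v w -> (forall l, count_mem l v = 1) -> (forall l, count_mem l w != 1) ->
  w = full_word.
Proof.
move=> sw w2 vw v1 w1; apply: sorted_count_eq sw full_word_sorted _ => l.
rewrite count_power_word; have := w2 l; have := w1 l; have := leq_count_subseq (pred1 l) vw.
by rewrite /= v1; case: (count_mem l w) => [|[|[|]]].
Qed.

Lemma full_marks_critical s : top s = full_word -> good s -> apex (top s) \notin marks s ->
  (forall p, rend full_word p -> p \in marks (add_apex s)) -> s = critical.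
Proof.
move=> sE gs na allp; have sn : top s != [::] by rewrite sE full_word_n0.
apply: marks_eq; first by rewrite sE top_mk.
move=> p; rewrite mem_marks_mk.
have [pa|pa] := eqVneq p (apex full_word).
  by rewrite andbF andbF pa -sE (negbTE na).
rewrite andbT; apply/idP/andP => [ps|[_ rp]].
  by rewrite -sE (marks_lt ps); split=> //; move: gs; rewrite goodE => /allP /(_ p ps).
by have := allp p rp; rewrite mem_add // sE (negbTE pa) orbF.
Qed.

(** If the missing word v is a new vertex, then the vertex above it has the apex
    letter twice.  By the choice of the apex no letter occurs once in the top
    word, which is therefore the full word, and reaching v from it takes all its
    marks: the block is the critical one. *)
Lemma add_apex_cell i s : cellb i s -> lower_end s -> cellb i.+1 (add_apex s).
Proof.
move=> cs /and3P[sn na nc]; have [gs ds sW] := cell_grid cs.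
have /and3P[ss /forallP s2 _] := cell_top cs.
have ga := good_add gs sn.
apply/and3P; split=> //; first by rewrite dim_add // ds.
apply/allP => v; rewrite [mem _ v]/= mem_grid top_add => vv.
have vs : subseq v (top s) := verts_subseq vv.
apply/and3P; split; first exact: (subseq_sorted le_letter_trans vs ss).
  by apply/forallP => l; apply: leq_trans (leq_count_subseq _ vs) (s2 l).
apply: contraNT nc; rewrite negb_exists => /forallP v1.
have {}v1 l : count_mem l v = 1 by apply/eqP/negbNE/v1.
have aE : nth ord0 (top s) (apex (top s)) = apex_letter (top s).
  by apply/nth_lastpos/apex_letter_in.
have ain : apex (top s) \in marks (add_apex s) by rewrite mem_add // eqxx orbT.
have mlt : all (fun q => q < size (top s)) (marks (add_apex s)).
  by apply/allP => q /marks_lt; rewrite top_add.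
have [|[v']] := verts_rem ord0 (marks_sorted _) mlt ain vv; rewrite rem_add //.
  by move=> /sW /and3P[_ _ /existsP[l]]; rewrite v1.
move=> /verts_subseq v's pe.
have a2 : count_mem (apex_letter (top s)) (top s) = 2.
  apply/eqP; rewrite eqn_leq s2 /=.
  apply: leq_trans (leq_count_subseq (pred1 (apex_letter (top s))) v's).
  by have /permP -> := pe; rewrite /= aE eqxx v1.
have no1 l : count_mem l (top s) != 1.
  move: a2; rewrite /apex_letter; case: pickP => [l' /eqP ->|no _] //.
  by rewrite no.
have sE : top s = full_word := all_ones_full ss s2 vs v1 no1.
apply/eqP/full_marks_critical => // p rp.
suff -> : marks (add_apex s) =i run_ends (top (add_apex s)) by rewrite mem_run_ends top_add sE.
apply: all_run_ends => //; rewrite ?top_add // -size_marks.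
have := size_verts vv; rewrite (size_const v1) sE size_full_word.
by rewrite muln1 muln2 -addnn leq_add2l.
Qed.

Lemma critical_good : good critical.
Proof. by apply: good_mk => p /andP[]. Qed.

Lemma dim_critical : dim critical = k.+1.
Proof.
rewrite -size_marks; apply: succn_inj; rewrite -[RHS]size_run_ends_full.
have -> : (size (marks critical)).+1 = size (apex full_word :: marks critical) by [].
apply/perm_size/uniq_perm; rewrite ?uniq_run_ends //=.
  by rewrite uniq_marks mem_marks_mk eqxx !andbF.
move=> p; rewrite inE mem_marks_mk mem_run_ends; case: eqP => [->|_] /=.
  by rewrite (apex_rend full_word_n0).
by rewrite andbT; case: (boolP (rend _ p)) => [/rend_size ->|_] //; rewrite andbF.
Qed.

Lemma critical_cell : cellb k.+1 critical.
Proof.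
apply/and3P; split; [exact: critical_good|by rewrite dim_critical|].
apply/allP => v; rewrite [mem _ v]/= mem_grid => vv.
have := verts_subseq vv; rewrite top_mk => vs.
apply/and3P; split; first exact: (subseq_sorted le_letter_trans vs full_word_sorted).
  by apply/forallP => l; apply: leq_trans (leq_count_subseq _ vs) _; rewrite count_power_word.
apply/existsP; apply: contrapT => no.
have v1 l : count_mem l v = 1 by apply/eqP; apply: contrapT => /negP nl; apply: no; exists l.
have := size_verts vv; rewrite top_mk size_full_word (size_const v1) size_marks dim_critical.
by rewrite muln1 muln2 -addnn leq_add2l ltnn.
Qed.

(** The bottom of a block with all the run ends of the full word as marks is the
    word that the grid omits. *)
Lemma no_full_cell i t : cellb i t -> top t = full_word ->
  (forall p, rend full_word p -> p \in marks t) -> False.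
Proof.
move=> ct tE allp; have [gt _ tW] := cell_grid ct.
have mE : perm_eq (marks t) (run_ends full_word).
  apply: uniq_perm; rewrite ?uniq_marks ?uniq_run_ends // => p; rewrite mem_run_ends.
  by apply/idP/idP => [/(marks_run_ends gt)|/allp //]; rewrite tE mem_run_ends.
have := bot_letters ord0 t; rewrite tE => /permP ct2.
have : in_grid (bot t) by apply: tW; apply/mem_verts; exists (pred0 : pred nat).
case/and3P => _ _ /existsP[l]; have := ct2 (pred1 l); rewrite count_power_word count_cat.
have /permP -> := perm_map (nth ord0 full_word) mE; rewrite [X in _ + X]count_uniq_mem; last first.
  exact: (run_letters_uniq full_word_sorted).
have -> : l \in [seq nth ord0 full_word p | p <- run_ends full_word].
  have lw : l \in full_word by rewrite -has_pred1 has_count count_power_word.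
  by apply/mapP; exists (lastpos full_word l); rewrite ?mem_run_ends ?lastpos_rend ?nth_lastpos.
by rewrite addn1 => -[<-].
Qed.

Lemma apex_full_free i t : cellb i t -> top t = full_word -> apex full_word \in marks t ->
  (forall p, p \in marks critical -> p \in marks t) -> False.
Proof.
move=> ct tE at_ ctm; apply: (no_full_cell ct tE) => p rp.
have [->//|pa] := eqVneq p (apex full_word).
by apply: ctm; rewrite mem_marks_mk pa rp (rend_size rp).
Qed.

Lemma grid_sphere : sphere_homology grid k.+1.
Proof.
have v0g : cellb 0 (Word [::]).
  apply/and3P; split=> //; rewrite /= andbT mem_grid.
  by apply/and3P; split=> //; [apply/forallP | apply/existsP; exists ord0].
apply: (@sphere_of_matching _ grid lower_end add_apex drop_apex (fun s => size (top s)) (Word [::])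
   _ _ _ _ v0g k critical critical_cell).
- exact: add_apex_cell.
- move=> i s cs /and3P[sn na _]; have [j js {1 3}->] := upper_add na sn.
  have [gs _ _] := cell_grid cs; rewrite coeff_bdry_upper //; last exact: good_add.
  by rewrite -expr2 sqrr_sign.
- move=> i s s' cs us cs' /and3P[sn' na' _] ne nz; have /and3P[sn na _] := us.
  have [ga _ _] := cell_grid (add_apex_cell cs us).
  have [j sj [e|[_ e]]] := coeff_bdry_neq0 ga nz.
    case: ne; apply: marks_eq; first by rewrite e top_upper top_add.
    have st : top s' = top s by rewrite e top_upper top_add.
    have pj : pos (add_apex s) j = apex (top s).
      apply/eqP; apply: contraNT na' => pj; rewrite st e mem_marks_upper // eq_sym pj.
      by rewrite mem_add // eqxx orbT.
    by move=> p; rewrite {1}e marks_upper // pj rem_add.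
  rewrite e (top_equiv (canon_equiv _)) -[top s]top_add -(size_top_lower sj).
  exact: ltnSn.
- move=> i t ct nt [s [cs us ->]]; have /and3P[sn na _] := us.
  by rewrite drop_add.
- move=> i t ct; have [gt dt tW] := cell_grid ct.
  have [t0|tn] := eqVneq (top t) [::].
    apply: Or43; apply: marks_eq; rewrite ?t0 // => p; apply/idP => /marks_lt.
    by rewrite t0.
  have [at_|na] := boolP (apex (top t) \in marks t); last first.
    have [->|nc] := eqVneq t critical; first exact: Or44.
    by apply: Or41; rewrite /lower_end tn na nc.
  apply: Or42; have [j sj pj] := pos_ex at_.
  have i0 : 0 < i by rewrite -dt; case/andP: sj => j0; apply: leq_trans.
  have dE : drop_apex t = upper_facet j t.
    apply: marks_eq; first by rewrite top_drop top_upper.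
    by move=> p; rewrite mem_drop_apex mem_marks_upper // pj andbC.
  split=> //; exists (drop_apex t); split; last by rewrite add_drop.
    by rewrite dE; apply: cellb_upper; rewrite ?prednK -?dt // dt.
  apply/and3P; split; rewrite ?top_drop // ?mem_drop_apex ?eqxx ?andbF //.
  apply/eqP => dc; have tE : top t = full_word by rewrite -(top_drop t) dc top_mk.
  apply: (apex_full_free ct tE); first by rewrite -tE.
  by move=> p; rewrite -dc mem_drop_apex => /andP[].
- move=> t ct; apply/eqP/negPn/negP => nz; have [gt dt tW] := cell_grid ct.
  have [j sj [e|[_ e]]] := coeff_bdry_neq0 gt nz.
    have tE : top t = full_word by rewrite -(top_upper t j) -e top_mk.
    apply: (apex_full_free ct tE) => [|p]; last by rewrite e mem_marks_upper // => /andP[].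
    suff <- : pos t j = apex full_word by apply: pos_in.
    have pr : rend full_word (pos t j).
      by move: gt; rewrite goodE -tE => /allP; apply; apply: pos_in.
    apply/eqP; apply: contraT => pa.
    have : pos t j \in marks critical by rewrite mem_marks_mk pa pr (rend_size pr).
    by rewrite e mem_marks_upper // eqxx.
  have := congr1 (fun s => size (top s)) e.
  rewrite /= (top_equiv (canon_equiv _)) top_mk size_full_word => st.
  have := size_top_lower sj; rewrite -st size_count => le.
  have /and3P[_ /forallP t2 _] := cell_top ct.
  have : \sum_l count_mem l (top t) <= \sum_(l : letter) 2 by apply: leq_sum.
  by rewrite -le sum_nat_const card_ord ltnn.
- move=> [s [_ /and3P[sn _ _]]] => e.
  have : apex full_word \in marks (add_apex s).
    have sE : top s = full_word by rewrite -(top_add s) -e top_mk.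
    by rewrite mem_add // sE eqxx orbT.
  by rewrite -e mem_marks_mk eqxx !andbF.
Qed.

End Grid.

(** * Cycles carried by few words *)

Section FewWords.
Local Open Scope ring_scope.
Variables (A : choiceType) (W : {fset seq A}).
Implicit Types (s t : block A) (k : nat) (x y z : bchain A).

Local Notation cellb := (cellb W).

Lemma uniq_leq_card (l : seq (seq A)) : uniq l -> {subset l <= W} -> (size l <= #|` W|)%N.
Proof. exact: uniq_leq_size. Qed.

Lemma uniq_full (l : seq (seq A)) : uniq l -> {subset l <= W} ->
  (#|` W| <= size l)%N -> {subset W <= l}.
Proof. by move=> ul lW le v vW; have [_ ->] := uniq_min_size ul lW le. Qed.

Lemma neq_size (u v : seq A) : size u <> size v -> u != v.
Proof. by move=> uv; apply/eqP => e; rewrite e in uv. Qed.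

Lemma neq_del (w : seq A) p : (p < size w)%N -> w != del p w.
Proof. by move=> pw; apply: neq_size; rewrite size_del //; lia. Qed.

Lemma del_del_fresh (w : seq A) p q p' : (p < size w)%N -> (p' < size w)%N ->
  (q < size (del p w))%N -> del q (del p w) \notin [:: w; del p w; del p' w].
Proof.
move=> pw pw' qw; rewrite !inE !negb_or; rewrite size_del // in qw.
by apply/and3P; split; apply: neq_size; rewrite !size_del //; lia.
Qed.

Lemma cellb_verts k s v : cellb k s -> v \in verts (top s) (marks s) -> v \in W.
Proof. by case/and3P => _ _ /allP h /h. Qed.

Lemma cellb_rend k s p : cellb k s -> p \in marks s -> rend (top s) p.
Proof. by case/and3P; rewrite goodE => /allP h _ _ /h. Qed.

(** In a cycle the contributions to a facet cancel, so no facet is met once. *)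
Lemma cycle_other z s e : bdry z = 0 -> s \in dom z -> coeff e (bdry_block s) != 0 ->
  exists s', [/\ s' \in dom z, s' <> s & coeff e (bdry_block s') != 0].
Proof.
move=> dz sz es; apply: contrapT => no.
have := coeff_bdry e z; rewrite dz coeff0 (bigD1_seq s) ?uniq_dom //=.
rewrite big_seq_cond big1 => [|s' /andP[sz' /eqP ne]]; last first.
  apply/eqP; rewrite mulf_eq0; apply/orP; right; apply/negPn/negP => nz.
  by apply: no; exists s'.
rewrite addr0 => /esym /eqP; rewrite mulf_eq0 (negbTE es) orbF.
by apply/negP; rewrite -mem_dom.
Qed.

Lemma longest z : z <> 0 -> exists2 s, s \in dom z &
  forall s', s' \in dom z -> (size (top s') <= size (top s))%N.
Proof.
move/eqP; rewrite -dom_eq0 => /eqP.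
elim: (dom z) => // t l IHl _; have [->|/eqP /IHl [u ul um]] := eqVneq l [::].
  by exists t; rewrite ?inE // => t'; rewrite inE => /eqP ->.
have [le|/ltnW le] := leqP (size (top u)) (size (top t)).
  exists t; rewrite ?inE ?eqxx // => t'; rewrite inE => /predU1P[->//|/um h].
  exact: leq_trans h le.
by exists u; rewrite ?inE ?ul ?orbT // => t'; rewrite inE => /predU1P[->|/um].
Qed.

(** A lower facet is a facet only once: its top word is shorter than that of the
    upper facets, and the top words of the lower facets are pairwise distinct. *)
Lemma coeff_bdry_lower s i : good s -> (0 < i <= dim s)%N ->
  separated (canon (lower_facet i s)) ->
  coeff (canon (lower_facet i s)) (bdry_block s) != 0.
Proof.
move=> gs si sc; rewrite coeff_bdry_block (bigD1_seq i) ?iota_uniq ?mem_index_iota //=.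
have up j : (0 < j <= dim s)%N -> coeff (canon (lower_facet i s)) (nu (upper_facet j s)) = 0.
  move=> sj; rewrite coeff_nu; case: (_ =P _); rewrite ?andbF //.
  move=> /(congr1 (fun t => size (top t))).
  rewrite !(top_equiv (canon_equiv _)) top_upper; have := size_top_lower si; lia.
rewrite up // coeff_nu eqxx sc big1_seq => [|j /andP[ji]].
  by rewrite addr0 sub0r mulrN1 oppr_eq0 signr_eq0.
rewrite mem_index_iota => sj; rewrite up // coeff_nu.
case: (canon _ =P _) => [/(congr1 (@top A))|]; rewrite ?andbF ?subrr ?mulr0 //.
rewrite !(top_equiv (canon_equiv _)) !top_lower // => /del_inj.
move: gs; rewrite goodE => /allP gs; rewrite !gs ?pos_in // => /(_ isT isT) /(pos_inj sj si) e.
by rewrite e eqxx in ji.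
Qed.

Lemma separated_small s : (dim s <= 1)%N -> separated s.
Proof. by case: s => [|[]]. Qed.

(** ** One-dimensional cycles *)

Lemma edge_marks s : cellb 1 s -> exists p, marks s = [:: p].
Proof.
move=> /cellb_dim; rewrite -size_marks; case: (marks s) => [|p [|]] // _.
by exists p.
Qed.

Lemma few_words_1cycle z : (#|` W| < 4)%N -> supp (cellb 1) z -> bdry z = 0 -> z = 0.
Proof.
move=> W4 sz dz; apply: contrapT => nz; have [s s_z smax] := longest nz.
have cz t : t \in dom z -> cellb 1 t by rewrite mem_dom => /sz.
have cs := cz s s_z; have gs := cellb_good cs; have ds := cellb_dim cs.
have [p ms] := edge_marks cs; set w := top s.
have s1 : (0 < 1 <= dim s)%N by rewrite ds.
have ps t q : marks t = [:: q] -> dim t = 1%N -> pos t 1 = q by move=> mt dt; rewrite /pos mt dt.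
have inW t q : cellb 1 t -> marks t = [:: q] -> top t \in W /\ del q (top t) \in W.
  by move=> ct mt; split; apply: (cellb_verts ct); rewrite mt !inE eqxx ?orbT.
have rs t q : cellb 1 t -> marks t = [:: q] -> rend (top t) q.
  by move=> ct mt; apply: (cellb_rend ct); rewrite mt inE.
have [wW wpW] := inW s p cs ms; rewrite -/w in wW wpW.
have rp := rs s p cs ms; rewrite -/w in rp; have pw := rend_size rp.
have u1 t : cellb 1 t -> upper_facet 1 t = Word (top t).
  move=> ct; apply: marks_eq; rewrite ?top_upper // => q.
  have [r mt] := edge_marks ct.
  by rewrite marks_upper ?(cellb_dim ct) // mt /pos mt (cellb_dim ct) /= eqxx.
have l1 t : cellb 1 t -> canon (lower_facet 1 t) = lower_facet 1 t.
  by move=> ct; rewrite canon_id //; have := dim_lower (_ : (0 < 1 <= dim t)%N);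
     rewrite (cellb_dim ct) => /(_ isT); case: lower_facet.
have nzc t e : cellb 1 t -> coeff e (bdry_block t) != 0 ->
    top e = top t \/ exists2 q, marks t = [:: q] & top e = del q (top t).
  move=> ct nz'; have dt := cellb_dim ct.
  have [i si [->|[_ ->]]] := coeff_bdry_neq0 (cellb_good ct) nz'; first by left; exact: top_upper.
  have e1 : i = 1%N by rewrite dt in si; lia.
  have [q mt] := edge_marks ct; right; exists q => //.
  by rewrite (top_equiv (canon_equiv _)) top_lower // e1 (ps t q).
(* Two edges of the cycle lead down from its longest word w. *)
have [s' [sz' ne' nz']] : exists s',
    [/\ s' \in dom z, s' <> s & coeff (upper_facet 1 s) (bdry_block s') != 0].
  by apply: cycle_other => //; rewrite coeff_bdry_upper // signr_eq0.
have cs' := cz s' sz'.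
have ts' : top s' = w.
  have [<-|[q ms' e]] := nzc _ _ cs' nz'; first by rewrite top_upper.
  move: e; rewrite top_upper => /(congr1 size); rewrite size_del; last first.
    by apply/rend_size/(rs s').
  have := smax s' sz'; have := rend_size (rs s' q cs' ms'); lia.
have [p' ms'] := edge_marks cs'.
have [_ wpW'] := inW s' p' cs' ms'; rewrite ts' in wpW'.
have rp' := rs s' p' cs' ms'; rewrite ts' in rp'; have pw' := rend_size rp'.
have pp' : del p w != del p' w.
  apply/eqP => /(del_inj rp rp') e; apply: ne'; apply: marks_eq; first by rewrite ts'.
  by move=> q; rewrite ms ms' e.
(* The first of the two edges meets the cycle at its lower end as well. *)
have [s2 [sz2 ne2 nz2]] : exists s2,
    [/\ s2 \in dom z, s2 <> s & coeff (canon (lower_facet 1 s)) (bdry_block s2) != 0].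
  apply: cycle_other => //; apply: coeff_bdry_lower => //; apply: separated_small.
  by rewrite dim_canon dim_lower ?ds.
have cs2 := cz s2 sz2; have [p2 ms2] := edge_marks cs2.
have [w2W wp2W] := inW s2 p2 cs2 ms2; have rp2 := rs s2 p2 cs2 ms2; have pw2 := rend_size rp2.
have tl : top (canon (lower_facet 1 s)) = del p w.
  by rewrite (top_equiv (canon_equiv _)) top_lower // (ps s p).
have bad v : v \in W -> v \notin [:: w; del p w; del p' w] -> False.
  move=> vW vn; have : (size [:: v; w; del p w; del p' w] <= #|` W|)%N.
    apply: uniq_leq_card => [|x]; last by rewrite !inE => /or4P[] /eqP ->.
    rewrite cons_uniq vn /= !inE negb_or pp' !andbT.
    by rewrite !neq_del.
  by move/(leq_trans W4); rewrite ltnn.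
have [t2|[q ms2' t2]] := nzc _ _ cs2 nz2; rewrite tl in t2.
  apply: (bad (del p2 (top s2))) => //; rewrite -t2.
  by apply: del_del_fresh; rewrite ?t2.
have {q ms2' t2} t2 : del p w = del p2 (top s2) by move: ms2' t2; rewrite ms2 => -[->].
have szt : size (top s2) = size w.
  move/(congr1 size): t2; rewrite !size_del // => e.
  by rewrite -(ltn_predK pw2) -e (ltn_predK pw).
apply: (bad (top s2)) => //; rewrite !inE !negb_or.
have nd q : (q < size w)%N -> top s2 != del q w.
  move=> qw; apply: neq_size; rewrite size_del // szt; apply/eqP.
  by rewrite gtn_eqF // prednK // (leq_ltn_trans _ qw).
rewrite !nd // !andbT.
apply/eqP => e; apply: ne2; apply: marks_eq => // q.
rewrite ms ms2; have -> // : p2 = p.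
by apply/esym/(del_inj rp); rewrite ?t2 -?e.
Qed.

Lemma no_circle : (#|` W| < 4)%N -> ~ iso_int (ICC_homology W 1).
Proof.
move=> W4; apply: ICC_not_int => x sx dx; exists 0; first exact: supp0.
by rewrite raddf0 (few_words_1cycle W4 sx dx).
Qed.

End FewWords.

Section Squares.
Local Open Scope ring_scope.
Variables (A : choiceType) (W : {fset seq A}).
Implicit Types (s t : block A) (k : nat) (x y z : bchain A).

Local Notation cellb := (cellb W).

(** ** Two-dimensional cycles *)

Lemma size_del_del (w : seq A) p q : (p < size w)%N -> (q < size (del p w))%N ->
  (size (del q (del p w))).+2 = size w.
Proof. by move=> pw qw; rewrite size_del //; move: qw; rewrite size_del //; lia. Qed.

Lemma square_marks s : cellb 2 s -> exists p q, (p < q)%N /\ marks s = [:: q; p].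
Proof.
move=> /cellb_dim; rewrite -size_marks; have := marks_sorted s.
by case: (marks s) => [|q [|p []]] //= /andP[pq _] _; exists p, q.
Qed.

Lemma square_other s p : cellb 2 s -> p \in marks s ->
  exists q, [/\ q != p, q \in marks s & marks s =i [:: p; q]].
Proof.
move=> /square_marks[a [b [ab ->]]]; rewrite !inE => /orP[] /eqP ->.
  by exists a; rewrite !inE eqxx orbT; split=> //; rewrite neq_ltn ab.
exists b; rewrite !inE eqxx; split=> [||c]; rewrite ?neq_ltn ?ab ?orbT //.
by rewrite !inE orbC.
Qed.

Lemma square_eq s t p q : cellb 2 s -> cellb 2 t -> top s = top t -> q != p ->
  p \in marks s -> q \in marks s -> p \in marks t -> q \in marks t -> s = t.
Proof.
move=> cs ct st qp ps qs pt qt; apply: marks_eq => // c.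
have [q1 [_ _ e1]] := square_other cs ps; have [q2 [_ _ e2]] := square_other ct pt.
have e1' : q = q1 by move: qs; rewrite e1 !inE (negbTE qp) => /eqP.
have e2' : q = q2 by move: qt; rewrite e2 !inE (negbTE qp) => /eqP.
by rewrite e1 e2 -e1' -e2'.
Qed.

Lemma square_bot s p q : cellb 2 s -> (p < q)%N -> p \in marks s -> q \in marks s ->
  bot s = del p (del q (top s)).
Proof.
move=> /square_marks[a [b [ab ms]]]; rewrite bot_dels ms /= !inE.
move=> pq /orP[] /eqP pE /orP[] /eqP qE; subst p q => //.
- by rewrite ltnn in pq.
- by move: (ltn_trans ab pq); rewrite ltnn.
- by rewrite ltnn in pq.
Qed.

Lemma square_words s p : cellb 2 s -> p \in marks s ->
  [/\ top s \in W, del p (top s) \in W & bot s \in W].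
Proof.
move=> cs; have [a [b [ab ms]]] := square_marks cs.
have inW v : v \in verts (top s) (marks s) -> v \in W := @cellb_verts _ _ _ _ v cs.
rewrite ms in inW *; rewrite bot_dels ms /=.
by rewrite !inE => /orP[] /eqP ->; split; apply: inW; rewrite /= !inE eqxx ?orbT.
Qed.

Variable z : bchain A.
Hypothesis sz : supp (cellb 2) z.
Hypothesis dz : bdry z = 0.

Lemma dom_cell s : s \in dom z -> cellb 2 s. Proof. by rewrite mem_dom => /sz. Qed.

Definition longest_cell s := s \in dom z /\
  forall s', s' \in dom z -> (size (top s') <= size (top s))%N.

(** An edge whose top word is longest can only be an upper facet of a square of
    z, so the squares that cancel on it have the same top word. *)
Lemma longest_edge s p : longest_cell s -> p \in marks s ->
  exists s', [/\ s' \in dom z, s' <> s, top s' = top s & p \in marks s'].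
Proof.
move=> [sd smax] ps; have cs := dom_cell sd; have gs := cellb_good cs.
have [q [qp qs _]] := square_other cs ps; have [i si iq] := pos_ex qs.
have [s' [sd' ne nz]] : exists s',
    [/\ s' \in dom z, s' <> s & coeff (upper_facet i s) (bdry_block s') != 0].
  by apply: cycle_other => //; rewrite coeff_bdry_upper // signr_eq0.
have cs' := dom_cell sd'; exists s'; split=> //;
  have [j sj [e|[_ e]]] := coeff_bdry_neq0 (cellb_good cs') nz.
- by rewrite -(top_upper s' j) -e top_upper.
- have := smax s' sd'; move/(congr1 (@top A)): e.
  rewrite (top_equiv (canon_equiv _)) top_upper => ->.
  by rewrite -(size_top_lower sj) ltnn.
- have : p \in marks (upper_facet i s) by rewrite mem_marks_upper // ps iq eq_sym qp.
  by rewrite e mem_marks_upper // => /andP[].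
- have := smax s' sd'; move/(congr1 (@top A)): e.
  rewrite (top_equiv (canon_equiv _)) top_upper => ->.
  by rewrite -(size_top_lower sj) ltnn.
Qed.

(** The mark r is the smallest of the squares with the given top word.  Deleting
    it merges no two runs to its right with one another, so that the squares with
    marks r, j and r, j' have different bottoms. *)
Lemma longest_squares s : longest_cell s -> exists s1 s2 s3 r j j' l,
  [/\ [/\ s1 \in dom z, s2 \in dom z & s3 \in dom z],
      [/\ top s1 = top s, top s2 = top s & top s3 = top s],
      [/\ marks s1 =i [:: r; j], marks s2 =i [:: r; j'] & marks s3 =i [:: j; l]],
      [/\ (r < j)%N, (r < j')%N & (r < l)%N] &
      [/\ j != j', l != j & forall t p, t \in dom z -> top t = top s ->
         p \in marks t -> (r <= p)%N]].
Proof.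
move=> ls; have [sd smax] := ls.
pose P r := has (fun t => (top t == top s) && (r \in marks t)) (dom z).
have exP : exists r, P r.
  have [p [q [_ ms]]] := square_marks (dom_cell sd); exists q.
  by apply/hasP; exists s => //; rewrite eqxx ms mem_head.
case: (ex_minnP exP) => r /hasP[s1 sd1 /andP[/eqP t1 r1]] rmin.
have rle t p : t \in dom z -> top t = top s -> p \in marks t -> (r <= p)%N.
  by move=> td tt pt; apply: rmin; apply/hasP; exists t; rewrite ?tt ?eqxx.
have ls1 : longest_cell s1 by split=> // s'; rewrite t1; apply: smax.
have cs1 := dom_cell sd1.
have [j [jr js1 m1]] := square_other cs1 r1.
have [s2 [sd2 ne2 t2 r2]] := longest_edge ls1 r1; rewrite t1 in t2.
have cs2 := dom_cell sd2; have [j' [jr' js2 m2]] := square_other cs2 r2.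
have [s3 [sd3 ne3 t3 j3]] := longest_edge ls1 js1; rewrite t1 in t3.
have cs3 := dom_cell sd3; have [l [lj ls3 m3]] := square_other cs3 j3.
exists s1, s2, s3, r, j, j', l; split=> //; split; rewrite ?lj //.
- by rewrite ltn_neqAle eq_sym jr (rle s1).
- by rewrite ltn_neqAle eq_sym jr' (rle s2).
- rewrite ltn_neqAle (rle s3) // andbT; apply/eqP => e; apply: ne3.
  by apply: (square_eq cs3 cs1 _ jr); rewrite ?t3 // e.
- apply/eqP => e; apply: ne2; apply: (square_eq cs2 cs1 _ jr); rewrite ?t2 //.
  by rewrite e.
Qed.

(** The clauses on the words of W make T depend on W alone; the last clause is
    contradicted once a multiple of the boundary of T has been subtracted from z. *)
Definition top_cube T := [/\ cellb 3 T,
  forall v, v \in W -> (size v < size (top T))%N \/ v = top T,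
  forall v, v \in W -> (size v).+1 = size (top T) -> exists2 p, p \in marks T & v = del p (top T)
  & forall i, (0 < i <= 3)%N -> upper_facet i T \in dom z].

(** The squares s1, s2, s3 at w and the square s4 below the deletion of r exhibit
    every vertex of the 3-block with top word w and marks r, j, j'. *)
Lemma build_cube w s1 s2 s3 s4 r j j' :
  [/\ s1 \in dom z, s2 \in dom z, s3 \in dom z & s4 \in dom z] ->
  [/\ top s1 = w, top s2 = w, top s3 = w & top s4 = del r w] ->
  [/\ marks s1 =i [:: r; j], marks s2 =i [:: r; j'] & marks s3 =i [:: j; j']] ->
  marks s4 =i [:: j.-1; j'.-1] -> (r < j)%N -> (j < j')%N ->
  (forall v, v \in W -> (size v < size w)%N \/ v = w) ->
  (forall v, v \in W -> (size v).+1 = size w -> v \in [:: del r w; del j w; del j' w]) ->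
  exists T, top_cube T.
Proof.
move=> [d1 d2 d3 d4] [t1 t2 t3 t4] [m1 m2 m3] m4 rj jj' hW hW'.
have [c1 c2 c3 c4] : [/\ cellb 2 s1, cellb 2 s2, cellb 2 s3 & cellb 2 s4].
  by split; apply: dom_cell.
have rj' := ltn_trans rj jj'.
have rr : rend w r by rewrite -t1; apply: (cellb_rend c1); rewrite m1 !inE eqxx.
have rendj : rend w j by rewrite -t1; apply: (cellb_rend c1); rewrite m1 !inE eqxx orbT.
have rendj' : rend w j' by rewrite -t2; apply: (cellb_rend c2); rewrite m2 !inE eqxx orbT.
have sj' := rend_size rendj'.
pose T := mk w (fun p => p \in [:: r; j; j']).
have tT : top T = w by rewrite /T top_mk.
have mT p : (p \in marks T) = (p \in [:: r; j; j']).
  rewrite /T mem_marks_mk; case: (boolP (p \in _)) => [|_]; rewrite ?andbF // andbT.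
  by rewrite !inE => /or3P[] /eqP ->; apply: rend_size.
have mTE : marks T = [:: j'; j; r].
  apply: (irr_sorted_eq (leT := gtn)) => [a b c /= ab bc|a /=|||p].
  - exact: ltn_trans bc ab.
  - by rewrite ltnn.
  - exact: marks_sorted.
  - by rewrite /= jj' rj.
  - by rewrite mT !inE; case: (p == r); case: (p == j); case: (p == j').
have gT : good T by apply: good_mk => p; rewrite !inE => /or3P[] /eqP ->.
have dT : dim T = 3 by rewrite -size_marks mTE.
have in1 : r \in marks s1 /\ j \in marks s1 by rewrite !m1 !inE !eqxx orbT.
have in2 : r \in marks s2 /\ j' \in marks s2 by rewrite !m2 !inE !eqxx orbT.
have in3 : j \in marks s3 /\ j' \in marks s3 by rewrite !m3 !inE !eqxx orbT.
have in4 : j.-1 \in marks s4 /\ j'.-1 \in marks s4 by rewrite !m4 !inE !eqxx orbT.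
have [wW wrW b1W] := square_words c1 in1.1; have [_ wjW _] := square_words c1 in1.2.
have [_ wj'W b2W] := square_words c2 in2.2; have [_ _ b3W] := square_words c3 in3.1.
have [_ _ b4W] := square_words c4 in4.1.
rewrite (square_bot c1 rj in1.1 in1.2) t1 in b1W; rewrite (square_bot c2 rj' in2.1 in2.2) t2 in b2W.
rewrite (square_bot c3 jj' in3.1 in3.2) t3 in b3W.
have j0 : (0 < j)%N by apply: leq_ltn_trans rj.
have jj1 : (j.-1 < j'.-1)%N by rewrite -ltnS (ltn_predK j0) (ltn_predK jj').
rewrite (square_bot c4 jj1 in4.1 in4.2) t4 -(del_del rj' sj') -(del_del rj) in b4W; last first.
  by rewrite size_del // (leq_trans jj') // -ltnS (ltn_predK sj').
rewrite t1 in wW wrW wjW; rewrite t2 in wj'W.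
exists T; split; rewrite ?tT //.
- apply/and3P; split=> //; first by rewrite dT.
  rewrite tT mTE; apply/allP => v /=; rewrite !inE.
  by move=> /orP[|/orP[|/orP[|/orP[|/orP[|/orP[|/orP[|]]]]]]] /eqP ->.
- move=> v vW vs; have := hW' v vW vs; rewrite !inE => /or3P[] /eqP ->.
  + by exists r; rewrite ?mT ?inE ?eqxx.
  + by exists j; rewrite ?mT ?inE ?eqxx ?orbT.
  + by exists j'; rewrite ?mT ?inE ?eqxx ?orbT.
- move=> i i3; have iT : (0 < i <= dim T)%N by rewrite dT.
  have tU : top (upper_facet i T) = w by rewrite top_upper.
  have := pos_in iT; rewrite mT !inE => /or3P[] /eqP ip.
  + suff <- : s3 = upper_facet i T by [].
    apply: marks_eq; rewrite ?tU // => p; rewrite m3 mem_marks_upper // mT ip !inE.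
    by case: (p =P r) => [->|//]; rewrite (ltn_eqF rj) (ltn_eqF rj').
  + suff <- : s2 = upper_facet i T by [].
    apply: marks_eq; rewrite ?tU // => p; rewrite m2 mem_marks_upper // mT ip !inE.
    case: (p =P j) => [->|]; last by case: (p == r).
    by rewrite (gtn_eqF rj) (ltn_eqF jj').
  + suff <- : s1 = upper_facet i T by [].
    apply: marks_eq; rewrite ?tU // => p; rewrite m1 mem_marks_upper // mT ip !inE.
    case: (p =P j') => [->|]; last by case: (p == r); case: (p == j).
    by rewrite (gtn_eqF rj') (gtn_eqF jj').
Qed.

Lemma fresh_deletion (w w' : seq A) (l l' : seq (seq A)) : size w = size w' -> w <> w' ->
  (forall v : seq A, v \in l -> exists2 p, (p < size w)%N & v = del p w) ->
  (forall v : seq A, v \in l' -> exists2 p, (p < size w')%N & v = del p w') ->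
  uniq l -> (2 < size l)%N -> exists2 v, v \in l & v \notin l'.
Proof.
move=> sw ww' lw lw' ul l3; have [d1 [d2 two]] := two_common_deletions sw ww'.
apply: contrapT => no; have : (size l <= size [:: d1; d2])%N.
  apply: uniq_leq_size => // x xl; have [p pw xp] := lw x xl.
  have xl' : x \in l' by apply: contrapT => /negP xl'; apply: no; exists x.
  have [p' pw' xp'] := lw' x xl'.
  by rewrite !inE; have [->|->] := two x p p' pw pw' xp xp'; rewrite eqxx ?orbT.
by rewrite leqNgt l3.
Qed.

Lemma uniq_cat_size (l1 l2 : seq (seq A)) n : uniq l1 -> uniq l2 ->
  all (fun v => n < size v)%N l1 -> all (fun v => size v <= n)%N l2 -> uniq (l1 ++ l2).
Proof.
move=> u1 u2 /allP s1 /allP s2; rewrite cat_uniq u1 u2 andbT /=.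
by apply/hasPn => v /s2 le; apply/negP => /s1; rewrite ltnNge le.
Qed.

Lemma longest_deletions s : longest_cell s -> exists l : seq (seq A),
  [/\ uniq l, (2 < size l)%N, {subset l <= W} &
   forall v, v \in l -> exists2 p, (p < size (top s))%N & v = del p (top s)].
Proof.
move=> /longest_squares[s1 [s2 [s3 [r [j [j' [l]]]]]]].
move=> [[d1 d2 d3] [t1 t2 t3] [m1 m2 m3] [rj rj' rl] [jj' lj rmin]].
have [c1 c2] := (dom_cell d1, dom_cell d2).
have r1 : r \in marks s1 by rewrite m1 !inE eqxx.
have j1 : j \in marks s1 by rewrite m1 !inE eqxx orbT.
have j2 : j' \in marks s2 by rewrite m2 !inE eqxx orbT.
have [rr rendj] := (cellb_rend c1 r1, cellb_rend c1 j1); have rendj' := cellb_rend c2 j2.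
rewrite t1 in rr rendj; rewrite t2 in rendj'.
have [_ wr _] := square_words c1 r1; have [_ wj _] := square_words c1 j1.
have [_ wj' _] := square_words c2 j2; rewrite t1 in wr wj; rewrite t2 in wj'.
exists [:: del r (top s); del j (top s); del j' (top s)]; split=> //.
- rewrite /= !inE negb_or andbT; apply/andP; split; first (apply/andP; split).
  + by apply/eqP => /(del_inj rr rendj) e; rewrite e ltnn in rj.
  + by apply/eqP => /(del_inj rr rendj') e; rewrite e ltnn in rj'.
  + by apply/eqP => /(del_inj rendj rendj') e; rewrite e eqxx in jj'.
- by move=> v; rewrite !inE => /or3P[] /eqP ->.
- move=> v; rewrite !inE => /or3P[] /eqP ->; [exists r|exists j|exists j'] => //;
  exact: rend_size.
Qed.

Lemma seven_words s : (#|` W| < 8)%N -> longest_cell s -> exists T, top_cube T.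
Proof.
move=> W8 ls; have [sd smax] := ls.
have [s1 [s2 [s3 [r [j [j' [l]]]]]]] := longest_squares ls.
move=> [[d1 d2 d3] [t1 t2 t3] [m1 m2 m3] [rj rj' rl] [jj' lj rmin]].
set w := top s in t1 t2 t3 smax.
have [c1 c2 c3] : [/\ cellb 2 s1, cellb 2 s2 & cellb 2 s3] by split; apply: dom_cell.
have r1 : r \in marks s1 by rewrite m1 !inE eqxx.
have j1 : j \in marks s1 by rewrite m1 !inE eqxx orbT.
have r2 : r \in marks s2 by rewrite m2 !inE eqxx.
have j2 : j' \in marks s2 by rewrite m2 !inE eqxx orbT.
have l3 : l \in marks s3 by rewrite m3 !inE eqxx orbT.
have rr : rend w r by rewrite -t1; apply: cellb_rend c1 r1.
have rendj : rend w j by rewrite -t1; apply: cellb_rend c1 j1.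
have rendj' : rend w j' by rewrite -t2; apply: cellb_rend c2 j2.
have rendl : rend w l by rewrite -t3; apply: cellb_rend c3 l3.
have sr := rend_size rr; have sj := rend_size rendj; have sj' := rend_size rendj'.
have sl := rend_size rendl.
have [wW wrW b1W] := square_words c1 r1; have [_ wjW _] := square_words c1 j1.
have [_ wj'W b2W] := square_words c2 j2; have [_ wlW _] := square_words c3 l3.
rewrite t1 in wW wrW wjW; rewrite t2 in wj'W; rewrite t3 in wlW.
have b1E : bot s1 = del j.-1 (del r w) by rewrite (square_bot c1 rj) // t1 del_del.
have b2E : bot s2 = del j'.-1 (del r w) by rewrite (square_bot c2 rj') // t2 del_del.
have rendj1 : rend (del r w) j.-1 := rend_delS rj rendj.
have rendj1' : rend (del r w) j'.-1 := rend_delS rj' rendj'.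
have pred_eq : j.-1 = j'.-1 -> j = j'.
  by move=> e; rewrite -(ltn_predK rj) e (ltn_predK rj').
have swr : size (del r w) = (size w).-1 := size_del sr.
have sb1 : (size (bot s1)).+2 = size w by rewrite b1E size_del_del // (rend_size rendj1).
have sb2 : (size (bot s2)).+2 = size w by rewrite b2E size_del_del // (rend_size rendj1').
pose mids := [:: del r w; del j w; del j' w].
pose bots := [:: bot s1; bot s2].
have smids v : v \in mids -> (size v).+1 = size w.
  by rewrite !inE => /or3P[] /eqP ->; rewrite size_del //; apply: (ltn_predK sr).
have sbots v : v \in bots -> (size v).+2 = size w by rewrite !inE => /orP[] /eqP ->.
have umids : uniq mids.
  rewrite /= !inE negb_or andbT; apply/andP; split; first (apply/andP; split).
  + by apply/eqP => /(del_inj rr rendj) e; rewrite e ltnn in rj.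
  + by apply/eqP => /(del_inj rr rendj') e; rewrite e ltnn in rj'.
  + by apply/eqP => /(del_inj rendj rendj') e; rewrite e eqxx in jj'.
have ubots : uniq bots.
  rewrite /= inE andbT b1E b2E; apply/eqP => /(del_inj rendj1 rendj1') /pred_eq e.
  by rewrite e eqxx in jj'.
have midsW v : v \in mids -> v \in W by rewrite !inE => /or3P[] /eqP ->.
have botsW v : v \in bots -> v \in W by rewrite !inE => /orP[] /eqP ->.
have mids_bots : uniq (mids ++ bots).
  apply: (@uniq_cat_size _ _ (size w).-2) => //; apply/allP => v.
    by move/smids; rewrite -sb1 /= => -[->].
  by move/sbots => <-.
(* The lower edge of s1 below the deletion of r lies in another square. *)
have [i si ir] := pos_ex r1.
have sc : separated (canon (lower_facet i s1)).
  by apply: separated_small; rewrite dim_canon dim_lower // (cellb_dim c1).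
set e := canon (lower_facet i s1) in sc *.
have [s4 [d4 ne4 nz4]] : exists s4, [/\ s4 \in dom z, s4 <> s1 & coeff e (bdry_block s4) != 0].
  by apply: cycle_other => //; apply: coeff_bdry_lower => //; apply: cellb_good c1.
have c4 := dom_cell d4; have g4 := cellb_good c4.
have te : top e = del r w by rewrite (top_equiv (canon_equiv _)) top_lower // ir t1.
have be : bot e = bot s1 by rewrite (bot_equiv (canon_equiv _)) bot_lower.
have [q sq [eE|[_ eE]]] := coeff_bdry_neq0 g4 nz4; last first.
  (* It lies below a second longest word. *)
  exfalso; set w4 := top s4.
  have pq := pos_in sq; have rq := cellb_rend c4 pq; have sqq := rend_size rq.
  have e4 : del r w = del (pos s4 q) w4.
    by rewrite -te eE (top_equiv (canon_equiv _)) top_lower.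
  have b4 : bot s1 = bot s4 by rewrite -be eE (bot_equiv (canon_equiv _)) bot_lower.
  have sz4 : size w = size w4.
    move/(congr1 size): e4; rewrite !size_del // => h.
    by rewrite -(ltn_predK sr) h (ltn_predK sqq).
  have ww4 : w <> w4.
    move=> ww4; apply: ne4; have t41 : top s4 = top s1 by rewrite t1 -/w4 -ww4.
    have rq' : rend w (pos s4 q) by rewrite ww4.
    have e4' : del r w = del (pos s4 q) w by rewrite e4 ww4.
    have pr : pos s4 q = r := esym (del_inj rr rq' e4').
    rewrite pr in pq; have [x [xr x4 mx]] := square_other c4 pq.
    have rx : (r < x)%N by rewrite ltn_neqAle eq_sym xr (rmin s4) // -/w4 -ww4.
    have rendx := cellb_rend c4 x4; rewrite -/w4 -ww4 in rendx.
    have xE : x = j.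
      have b4' : bot s4 = del r (del x w) by rewrite (square_bot c4 rx pq x4) -/w4 -ww4.
      have : del x.-1 (del r w) = del j.-1 (del r w).
        by rewrite -b1E b4 b4' (del_del rx) // (rend_size rendx).
      move/(del_inj (rend_delS rx rendx) rendj1) => ex.
      by rewrite -(ltn_predK rx) ex (ltn_predK rj).
    by apply: (square_eq c4 c1 t41 xr); rewrite // xE.
  have ls4 : longest_cell s4 by split=> // t /smax; rewrite sz4.
  have [l4 [ul4 sl4 l4W l4d]] := longest_deletions ls4.
  have [|v vl4 vm] := fresh_deletion (esym sz4) (not_eq_sym ww4) l4d _ ul4 sl4 (l' := mids).
    by move=> v; rewrite !inE => /or3P[] /eqP ->; [exists r|exists j|exists j'].
  have vs : (size v).+1 = size w.
    by have [p pw ->] := l4d v vl4; rewrite size_del // (ltn_predK pw) sz4.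
  have : (size ([:: w; w4] ++ (v :: mids) ++ bots) <= #|` W|)%N.
    apply: uniq_leq_card.
      apply: (@uniq_cat_size _ _ (size w).-1); last 2 first.
      - by rewrite /= -sz4 -vs /= leqnn.
      - apply/allP => u; rewrite mem_cat inE -vs /=.
        move=> /orP[/predU1P[->//|/smids]|/sbots]; rewrite -vs.
          by move=> [->].
        by move=> [<-].
      - by rewrite /= inE andbT; apply/eqP.
      apply: (@uniq_cat_size _ _ (size w).-2) => //.
      - by rewrite cons_uniq vm.
      - apply/allP => u; rewrite inE -sb1 /= => /predU1P[->|/smids].
          by move: vs; rewrite -sb1 => -[->].
        by rewrite -sb1 => -[->].
      - by apply/allP => u /sbots <-.
    move=> u; rewrite !mem_cat => /orP[|/orP[]]; last exact: botsW.
      by rewrite !inE => /orP[] /eqP -> //; have [] := square_words c4 pq.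
    by rewrite inE => /predU1P[->|/midsW //]; apply: l4W.
  by rewrite leqNgt W8.
(* It lies above a word u of the fourth level, and W consists of seven words. *)
have t4 : top s4 = del r w by rewrite -te eE top_upper.
have [a [b [ab m4]]] := square_marks c4.
have a4 : a \in marks s4 by rewrite m4 !inE eqxx orbT.
have b4 : b \in marks s4 by rewrite m4 !inE eqxx.
have [ra rb] := (cellb_rend c4 a4, cellb_rend c4 b4); rewrite t4 in ra rb.
have [_ dbW uW] := square_words c4 b4; have [_ daW _] := square_words c4 a4.
rewrite t4 in daW dbW; set u := bot s4 in uW.
have sda p : rend (del r w) p -> (size (del p (del r w))).+2 = size w.
  by move=> rp; rewrite size_del_del // (rend_size rp).
have su : (size u).+3 = size w.
  rewrite /u (square_bot c4 ab a4 b4) t4 -(sda b rb); congr _.+2.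
  have ab' : (a < (size (del r w)).-1)%N.
    by rewrite (leq_trans ab) // -ltnS (ltn_predK (rend_size rb)) (rend_size rb).
  have sdb : size (del b (del r w)) = (size (del r w)).-1 := size_del (rend_size rb).
  by rewrite size_del sdb // (ltn_predK ab').
pose l7 := (w :: mids) ++ (bots ++ [:: u]).
have u7 : uniq l7.
  apply: (@uniq_cat_size _ _ (size w).-2).
  - rewrite cons_uniq umids andbT; apply/negP => /smids /eqP.
    by rewrite gtn_eqF.
  - apply: (@uniq_cat_size _ _ (size u)) => //=; last by rewrite leqnn.
    by move: sb1 sb2; rewrite -su => -[->] [->]; rewrite ltnSn.
  - apply/allP => v; rewrite inE -su /= => /predU1P[->|/smids]; first by rewrite -su ltnW.
    by rewrite -su => -[->].
  - apply/allP => v; rewrite mem_cat -su /= => /orP[/sbots|]; first by rewrite -su => -[->].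
    by rewrite inE => /eqP ->; apply: leqnSn.
have W7 v : v \in W -> v \in l7.
  apply: (uniq_full u7) => [x|]; last by rewrite -ltnS.
  rewrite !mem_cat => /orP[|/orP[]]; [|exact: botsW|by rewrite inE => /eqP ->].
  by rewrite inE => /predU1P[->//|/midsW].
have W7P v : v \in W -> [\/ v = w, v \in mids, v \in bots | v = u].
  move/W7; rewrite !mem_cat inE [v \in [:: u]]inE.
  case/orP => [/predU1P[]|/orP[|/eqP]]; first exact: Or41.
  - exact: Or42.
  - exact: Or43.
  - exact: Or44.
have hW v : v \in W -> (size v < size w)%N \/ v = w.
  case/W7P => [->|/smids <-|/sbots <-|->]; first by right.
  - by left.
  - by left; apply: leqnSn.
  - by left; rewrite -su ltnW // ltnW.
have hM v : v \in W -> (size v).+1 = size w -> v \in mids.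
  case/W7P => [->|//|/sbots <-|->] /eqP; rewrite -?su.
  - by rewrite gtn_eqF.
  - by rewrite ltn_eqF.
  - by rewrite ltn_eqF.
have hB v : v \in W -> (size v).+2 = size w -> v \in bots.
  case/W7P => [->|/smids <-|//|->] /eqP; rewrite -?su.
  - by rewrite gtn_eqF // ltnW.
  - by rewrite gtn_eqF.
  - by rewrite ltn_eqF.
have lj' : l = j'.
  have := hM _ wlW; rewrite size_del // (ltn_predK sl) => /(_ erefl).
  rewrite !inE => /or3P[] /eqP.
  + by move/(del_inj rendl rr) => lr; rewrite lr ltnn in rl.
  + by move/(del_inj rendl rendj) => lj0; rewrite lj0 eqxx in lj.
  + exact: del_inj.
rewrite lj' in m3.
have inB p : rend (del r w) p -> del p (del r w) \in W -> p \in [:: j.-1; j'.-1].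
  move=> rp pW; have := hB _ pW (sda p rp); rewrite !inE b1E b2E.
  by case/orP => /eqP e'; [rewrite (del_inj rp rendj1 e') | rewrite (del_inj rp rendj1' e')];
    rewrite eqxx ?orbT.
have mm4 : marks s4 =i [:: j.-1; j'.-1].
  have := inB a ra daW; have := inB b rb dbW; move=> hb ha p; rewrite m4.
  move: hb ha ab; rewrite !inE => /orP[] /eqP -> /orP[] /eqP ->; rewrite ?ltnn //.
  by rewrite orbC.
case: (ltngtP j j') jj' => [lt|lt|//].
- move=> _; apply: (build_cube (And4 d1 d2 d3 d4) (And4 t1 t2 t3 t4) _ mm4 rj lt hW hM).
  by split.
- move=> _; apply: (build_cube (s1 := s2) (s2 := s1) (j := j') (j' := j)
    (And4 d2 d1 d3 d4) (And4 t2 t1 t3 t4) _ _ rj' lt hW).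
  + by split=> // p; rewrite m3 !inE orbC.
  + by move=> p; rewrite mm4 !inE orbC.
  + by move=> v vW /(hM v vW); rewrite !inE => /or3P[] ->; rewrite ?orbT.
Qed.

End Squares.

Section NoSphere.
Local Open Scope ring_scope.
Variables (A : choiceType) (W : {fset seq A}).
Local Notation cellb := (cellb W).

(** Such a block is determined by W alone: its top word is the longest word of W,
    and its marks are given by the deletions of that word that lie in W. *)
Lemma top_cube_unique (z z' : bchain A) T T' : top_cube W z T -> top_cube W z' T' -> T = T'.
Proof.
move=> [cT lT mT _] [cT' lT' mT' _].
have inW t : cellb 3 t -> top t \in W.
  by move=> ct; apply: (cellb_verts ct); apply: top_verts.
have delW t p : cellb 3 t -> p \in marks t -> del p (top t) \in W.
  move=> ct pt; have [i si <-] := pos_ex pt; rewrite -top_lower //; apply: (cellb_verts ct).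
  by apply/mem_verts; rewrite /top /lower_facet vertex_subblock; eexists.
have tt : top T = top T'.
  have [lt|//] := lT' _ (inW _ cT); have [lt'|//] := lT _ (inW _ cT').
  by move: (ltn_trans lt lt'); rewrite ltnn.
apply: marks_eq => // p; apply/idP/idP => pT.
  have rp := cellb_rend cT pT; have := delW _ _ cT pT.
  rewrite tt => /mT'; rewrite -tt size_del ?rend_size // (ltn_predK (rend_size rp)).
  by case=> // q qT /(del_inj rp) ->; rewrite // tt (cellb_rend cT').
have rp := cellb_rend cT' pT; have := delW _ _ cT' pT.
rewrite -tt => /mT; rewrite tt size_del ?rend_size // (ltn_predK (rend_size rp)).
by case=> // q qT /(del_inj rp) ->; rewrite // -tt (cellb_rend cT).
Qed.

(** Subtracting from z a multiple of the boundary of T makes it vanish on a facet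
    of T.  What remains is a cycle, and if it were not zero, it would not vanish on
    that facet, since it leads to the same block T. *)
Lemma few_words_2cycle (z : bchain A) : (#|` W| < 8)%N -> supp (cellb 2) z -> bdry z = 0 ->
  exists2 y, supp (cellb 3) y & bdry y = z.
Proof.
move=> W8 sz dz; have [z0|/eqP nz] := eqVneq z 0.
  by exists 0; [exact: supp0 | rewrite raddf0].
have cube x : supp (cellb 2) x -> bdry x = 0 -> x <> 0 -> exists T, top_cube W x T.
  by move=> sx dx /longest[s sd smax]; apply: (seven_words sx dx W8 (s := s)).
have [T tcT] := cube z sz dz nz; have [cT _ _ upT] := tcT.
pose f := upper_facet 1 T; pose c := coeff f z * coeff f (bdry_block T).
have fT : coeff f (bdry_block T) = (-1) ^+ 2.
  by apply: coeff_bdry_upper; rewrite ?(cellb_dim cT) // (cellb_good cT).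
have sy : supp (cellb 3) (c *: << T >>) by apply/suppZ/supp_basis.
exists (c *: << T >>) => //; apply/eqP; rewrite -subr_eq0 -oppr_eq0 opprB; apply/eqP.
apply: contrapT => nz'; have [||T' tcT'] := cube _ _ _ nz'.
- by apply: suppD => //; apply/suppN/supp_bdry.
- by rewrite bdryB dz bdry_bdry subr0.
have [_ _ _ upT'] := tcT'; have := upT' 1 isT; rewrite -(top_cube_unique tcT tcT') mem_dom.
rewrite coeffB bdryZ coeffZ bdry_basis -/f /c fT.
by rewrite sqrrN expr1n !mulr1 subrr eqxx.
Qed.

Lemma no_sphere : (#|` W| < 8)%N -> ~ iso_int (ICC_homology W 2).
Proof. by move=> W8; apply: ICC_not_int => x sx dx; apply: few_words_2cycle. Qed.

End NoSphere.

(** * The minimal sizes *)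

Theorem theorem5p7 :
  [/\ mu_sphere 0 1,
      mu_sphere 1 4,
      mu_sphere 2 8
    & forall k : nat, 3 <= k ->
        exists2 n : nat, mu_sphere k n & n <= 3 ^ k.+1 - 1].
Proof.
split.
- split=> [|A W [hom _]].
    exists bool, (words [:: [::] : seq bool]); split; first exact: point_sphere.
    by rewrite card_words.
  rewrite cardfs_gt0; apply/eqP => W0.
  apply: (ICC_not_int (W := W) (k := 0) _ (hom 0 (or_introl erefl))) => x sx _.
  exists 0%R; first exact: supp0.
  rewrite raddf0; apply: (@coeff_ext A) => s; rewrite coeff0; apply/esym/eqP/negPn/negP => /sx cs.
  by have := cellb_verts cs (top_verts s); rewrite W0 in_fset0.
- split=> [|A W [hom _]].
    exists bool, (words circle_words); split; first exact: circle.
    by rewrite card_words.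
  by rewrite leqNgt; apply/negP => /no_circle; apply; apply: hom; right.
- split=> [|A W [hom _]].
    exists bool, (words sphere_words); split; first exact: sphere.
    by rewrite card_words.
  by rewrite leqNgt; apply/negP => /no_sphere; apply; apply: hom; right.
- case=> [//|k] _.
  pose attained n := `[< exists (A : finType) (W : {fset seq A}),
    sphere_homology W k.+1 /\ #|` W| = n >].
  have ex : exists n, attained n.
    by exists #|` grid k|; apply/asboolP; exists 'I_k.+2, (grid k); split; first exact: grid_sphere.
  case: (ex_minnP ex) => n /asboolP nW nmin; exists n.
    by split=> // A W hom; apply: nmin; apply/asboolP; exists A, W.
  apply: leq_trans (card_grid k); apply: nmin.
  by apply/asboolP; exists 'I_k.+2, (grid k); split; first exact: grid_sphere.
Qed.
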